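(* Let $D=\{(x,y)\in\mathbb{R}^2:(x-1/2)^2+y^2\le 1/4\}$, identified with a subset of $\mathbb{C}$ via $(x,y)\leftrightarrow x+\mathrm{i}y$. Let $U\subset\mathbb{R}^2=\mathbb{C}$ be a bounded, mildly regular open set with $\operatorname{int}(D)\subset U$ and $x>0$ for all $(x,y)\in U$; $\bar U$ denotes its closure. Let $\gamma\ge 1$ and let $\mathcal{B}$ be a finite set of complex numbers with $\operatorname{Re}(b)\ge\gamma$ for all $b\in\mathcal{B}$; for $b\in\mathcal{B}$ put $\theta_b(z)=1/(z+b)$. Let $R>0$, $\alpha\ge 0$, $\mathcal{B}_R=\{b\in\mathcal{B}:|b|\le R\}$, and assume $\alpha>0$ or $\mathcal{B}_R\neq\emptyset$. For $s\ge 0$ define $L_{s,R,\alpha}:C_{\mathbb{C}}(\bar U)\to C_{\mathbb{C}}(\bar U)$ by $$(L_{s,R,\alpha}f)(z)=\sum_{b\in\mathcal{B}_R}\frac{f(\theta_b(z))}{|z+b|^{2s}}+\alpha f(0).$$ Then for each $s\ge 0$ there exists a strictly positive continuous function $w_s\in C_{\mathbb{R}}(\bar U)$, unique up to scalar multiples, with $L_{s,R,\alpha}w_s=r(L_{s,R,\alpha})w_s$, where $r(L_{s,R,\alpha})=\lim_{k\to\infty}\|L_{s,R,\alpha}^k\|^{1/k}>0$. If $\mathcal{B}$ and $U$ are symmetric under conjugation, then $w_s(\bar z)=w_s(z)$ for all $z\in\bar U$. Moreover, writing $w_s(x,y)=w_s(x+\mathrm{i}y)$, $w_s$ is $C^\infty$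 on $\bar U$ and: (i) $w_s(z_0)\le w_s(z_1)\exp[(\sqrt5 s/\gamma)|z_1-z_0|]$ for all $z_0,z_1\in\bar U$; (ii) $w_s(x_1,y)\ge w_s(x_2,y)\ge w_s(x_1,y)\exp[(-2s/\gamma)(x_2-x_1)]$ whenever $0\le x_1\le x_2$ and $(x_1,y),(x_2,y)\in\bar U$; (iii) $w_s(x,y_1)\le w_s(x,y_2)\exp[(s/\gamma)|y_1-y_2|]$ whenever $(x,y_1),(x,y_2)\in\bar U$; (iv) $-\frac{s}{4\gamma^2(s+1)}w_s(x,y)\le D_{xx}w_s(x,y)\le\frac{2s(2s+1)}{\gamma^2}w_s(x,y)$; (v) $-\frac{2s}{\gamma^2}w_s(x,y)\le D_{yy}w_s(x,y)\le\frac{2s(2s+1)}{4\gamma^2}w_s(x,y)$, with (iv),(v) holding for $(x,y)\in\bar U$.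
   Context: A bounded open set $H\subset\mathbb{R}^n$ is mildly regular if there exist $\eta>0$ and $M\ge1$ such that whenever $x,y\in H$ and $\|x-y\|<\eta$, there is a Lipschitz map $\psi:[0,1]\to H$ with $\psi(0)=x$, $\psi(1)=y$ and $\int_0^1\|\psi'(t)\|\,dt\le M\|x-y\|$. $C_{\mathbb{C}}(\bar U)$ (resp. $C_{\mathbb{R}}(\bar U)$) is the Banach space of continuous complex- (resp. real-) valued functions on $\bar U$ with the sup norm. A set $S\subset\mathbb{C}$ is symmetric under conjugation if $S=\{\bar z:z\in S\}$. $D_{xx}=\partial^2/\partial x^2$, $D_{yy}=\partial^2/\partial y^2$; ''$C^\infty$ on $\bar U$'' means all partial derivatives exist on $U$ and extend continuously to $\bar U$. *)

(* Defs.v *)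
From HB Require Import structures.
From mathcomp Require Import all_boot all_order all_algebra.
From mathcomp Require Import all_classical all_reals all_analysis.
Set Implicit Arguments. Unset Strict Implicit. Unset Printing Implicit Defensive.
Import Order.TTheory GRing.Theory Num.Theory.
Import numFieldNormedType.Exports.
Local Open Scope classical_set_scope.
Local Open Scope ring_scope.

Section Defs.
Variable R : realType.
Implicit Types (z p b : R * R) (U H : set (R * R)).

Definition cadd z b : R * R := (z.1 + b.1, z.2 + b.2).
Definition csub z b : R * R := (z.1 - b.1, z.2 - b.2).
Definition cmod z : R := Num.sqrt (z.1 ^+ 2 + z.2 ^+ 2).
Definition conjc z : R * R := (z.1, - z.2).
Definition cinv z : R * R :=
  (z.1 / (z.1 ^+ 2 + z.2 ^+ 2), - z.2 / (z.1 ^+ 2 + z.2 ^+ 2)).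

Definition theta b z : R * R := cinv (cadd z b).

Definition Ddisk : set (R * R) :=
  [set p | (p.1 - 2^-1) ^+ 2 + p.2 ^+ 2 <= 4^-1].

Definition lipschitz_on (A : set R) (psi : R -> R * R) : Prop :=
  exists K : R, forall s t, A s -> A t -> cmod (csub (psi s) (psi t)) <= K * `|s - t|.

Definition mildly_regular H : Prop :=
  exists eta M : R, 0 < eta /\ 1 <= M /\
    forall x y, H x -> H y -> cmod (csub x y) < eta ->
      exists psi : R -> R * R,
        lipschitz_on [set` `[0%R, 1%R]] psi /\ psi 0 = x /\ psi 1 = y /\
        (forall t, [set` `[0%R, 1%R]] t -> H (psi t)) /\
        (\int[@lebesgue_measure R]_(t in `[0%R, 1%R])
            (cmod (derive1 (fun u => (psi u).1) t,
                   derive1 (fun u => (psi u).2) t))%:E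
          <= (M * cmod (csub x y))%:E)%E.

Definition Lop (B : seq (R * R)) (Rr al s : R) (f : R * R -> R) (z : R * R) : R :=
  \sum_(b <- B | cmod b <= Rr) f (theta b z) / (cmod (cadd z b) `^ (2 * s))
  + al * f (0, 0).

(* the same operator on complex-valued functions f = (Re f, Im f);
   the weights are real, so it acts componentwise *)
Definition LopC (B : seq (R * R)) (Rr al s : R) (f : R * R -> R * R) (z : R * R)
  : R * R :=
  (Lop B Rr al s (fun p => (f p).1) z, Lop B Rr al s (fun p => (f p).2) z).

Definition supn (A : set (R * R)) (f : R * R -> R * R) : R :=
  sup [set cmod (f z) | z in A].

Definition opnorm (A : set (R * R)) (T : (R * R -> R * R) -> (R * R -> R * R))
  (k : nat) : R :=
  sup [set supn A (iter k T f) |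
       f in [set f : R * R -> R * R | {within A, continuous f} /\ supn A f <= 1]].

Definition pdir (d : bool) (f : R * R -> R) : R * R -> R :=
  fun p => if d then derive1 (fun t => f (p.1, t)) p.2
           else derive1 (fun t => f (t, p.2)) p.1.

Definition pderivable (d : bool) (f : R * R -> R) (p : R * R) : Prop :=
  if d then derivable (fun t => f (p.1, t)) p.2 1
  else derivable (fun t => f (t, p.2)) p.1 1.

Definition pderiv (ds : seq bool) (f : R * R -> R) : R * R -> R :=
  foldr pdir f ds.

Definition pext U (f : R * R -> R) (ds : seq bool) (g : R * R -> R) : Prop :=
  {within closure U, continuous g} /\ forall p, U p -> g p = pderiv ds f p.

Definition smooth_closure U (f : R * R -> R) : Prop :=
  forall ds : seq bool,
    (forall d p, U p -> pderivable d (pderiv ds f) p) /\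
    exists g, pext U f ds g.

End Defs.

(* Main.v *)
(** The operator L maps z |-> |z + b|^(-2s) to a nonnegative combination of
    functions of the same kind and of the constant 1, because
    |1/(z+b) + B| |z + b| = |B| |z + (b + 1/B)|.  So L acts by a transposed
    operator T on functions of the parameter (b, or the point that stands for
    the constant).  On a bounded part of the half plane Re z >= 0 these functions
    lie between two positive constants, hence L^k 1 (0) is multiplicative up to a
    constant factor and grows like r^k.  An ultrafilter limit of the means of
    r^(-k) T^k is a positive functional Lam with Lam o T = r Lam, and
    w(z) = Lam (b |-> |z + b|^(-2s)) is an eigenfunction.  Every estimate of w and
    of its derivatives is an estimate of |z + b|^(-2s), uniform in b, to which Lam
    is applied.  For uniqueness, the minimum and the maximum of v/w propagate
    along the contractions theta_b (or to 0, if alpha > 0), so they coincide. *)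
Require Import Defs.
From HB Require Import structures.
From mathcomp Require Import all_boot all_order all_algebra.
From mathcomp Require Import all_classical all_reals all_analysis.
From mathcomp Require Import ring lra.
Set Implicit Arguments.
Unset Strict Implicit.
Unset Printing Implicit Defensive.
Import Order.TTheory GRing.Theory Num.Theory.
Import numFieldNormedType.Exports.
Local Open Scope classical_set_scope.
Local Open Scope ring_scope.

(* [cadd] alone would denote the sum of two charges. *)
Local Notation cadd := Defs.cadd.

(** * Powers of the modulus *)

Section InversePowers.
Variable R : realType.
Implicit Types (z u b : R * R) (s : R).

(** The obstacle is that L need not be compact on continuous functions, so an eigenvector does not
    come directly from compactness. The constant function 1 plays the part of the parameter at
    infinity, so that [alpha f(0)] fits the same pattern as the other terms. The parameters are
    confined to Re b >= gamma >= 1 and to a bounded region stable under b -> B + 1/b; this is the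
    source of every uniform constant. The resulting w lives on the whole half plane Re z >= 0,
    whatever the shape of U, and is differentiated through Lam by Taylor remainders uniform in b. *)

Definition sqmod z : R := z.1 ^+ 2 + z.2 ^+ 2.

(** This is |u|^(-2s) for nonzero u; being an exponential it is positive without any side
    condition. *)
Definition hpow s u : R := expR (- (s * ln (sqmod u))).

Lemma cmod_sq z : cmod z ^+ 2 = sqmod z.
Proof. by rewrite sqr_sqrtr // addr_ge0 ?sqr_ge0. Qed.

Lemma cmod_ge0 z : 0 <= cmod z.
Proof. exact: sqrtr_ge0. Qed.

Lemma sqmod_ge0 z : 0 <= sqmod z.
Proof. by rewrite addr_ge0 ?sqr_ge0. Qed.

Lemma sqmod_gt0 z : 0 < z.1 -> 0 < sqmod z.
Proof. by move=> h; rewrite ltr_pwDl ?sqr_ge0 // exprn_gt0. Qed.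

Lemma sqmod_ge1 z : 1 <= z.1 -> 1 <= sqmod z.
Proof. by move=> h; rewrite /sqmod; nra. Qed.

Lemma sqmod_addl z b : sqmod (cadd z b) <= 2 * sqmod z + 2 * sqmod b.
Proof.
rewrite /sqmod /cadd /=.
have := sqr_ge0 (z.1 - b.1); have := sqr_ge0 (z.2 - b.2); nra.
Qed.

Lemma sqmod_cinv z : 0 < sqmod z -> sqmod (cinv z) = (sqmod z)^-1.
Proof.
move=> h; have h0 : sqmod z != 0 by rewrite gt_eqF.
rewrite /cinv /sqmod /= -/(sqmod z) !expr_div_n -mulrDl sqrrN -/(sqmod z).
by rewrite expr2 invfM mulrA divff // mul1r.
Qed.

Lemma cinv_re_ge0 z : 0 <= z.1 -> 0 <= (cinv z).1.
Proof. by move=> h; rewrite /cinv /= divr_ge0 ?sqmod_ge0. Qed.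

Lemma sqmod_theta z b B : 0 < sqmod (cadd z b) -> 0 < sqmod B ->
  sqmod (cadd (theta b z) B) * sqmod (cadd z b) =
  sqmod B * sqmod (cadd z (cadd b (cinv B))).
Proof.
case: z b B => [x y] [b1 b2] [B1 B2]; rewrite /theta /cadd /cinv /sqmod /=.
move=> /lt0r_neq0 h1 /lt0r_neq0 h2.
field; by rewrite h1 h2.
Qed.

Lemma hpow_gt0 s u : 0 < hpow s u.
Proof. exact: expR_gt0. Qed.

Lemma hpowM s u v u' v' : 0 < sqmod u -> 0 < sqmod v ->
  0 < sqmod u' -> 0 < sqmod v' ->
  sqmod u * sqmod v = sqmod u' * sqmod v' ->
  hpow s u * hpow s v = hpow s u' * hpow s v'.
Proof.
move=> hu hv hu' hv' h; rewrite /hpow -!expRD -!opprD -!mulrDr.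
by rewrite -!lnM ?posrE // h.
Qed.

Lemma hpow_le s u v : 0 <= s -> 0 < sqmod u -> sqmod u <= sqmod v ->
  hpow s v <= hpow s u.
Proof.
move=> s0 hu huv; rewrite /hpow ler_expR lerN2 ler_wpM2l //.
by rewrite ler_ln // posrE // (lt_le_trans hu).
Qed.

Lemma hpow_le1 s u : 0 <= s -> 1 <= sqmod u -> hpow s u <= 1.
Proof.
move=> s0 hu; rewrite /hpow -[leRHS](@expR0 R) ler_expR oppr_le0 mulr_ge0 //.
exact: ln_ge0.
Qed.

Lemma hpow_le_exp s t u v : 0 <= s -> 0 < sqmod u -> 0 < sqmod v ->
  sqmod v <= sqmod u * expR t -> hpow s u * expR (- (s * t)) <= hpow s v.
Proof.
move=> s0 hu hv h; rewrite /hpow -expRD ler_expR -opprD -mulrDr lerN2.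
rewrite ler_wpM2l // -[t](@expRK R) -lnM ?posrE ?expR_gt0 //.
by rewrite ler_ln ?posrE // mulr_gt0 ?expR_gt0.
Qed.

Lemma hpow_cmod s u : 0 < sqmod u -> (cmod u `^ (2 * s))^-1 = hpow s u.
Proof.
move=> hu; have c0 : 0 < cmod u by rewrite sqrtr_gt0.
rewrite /powR gt_eqF // -expRN /hpow -cmod_sq lnXn //.
by congr (expR (- _)); rewrite mulr2n; ring.
Qed.

End InversePowers.

(** * The transposed operator on parameters *)

Section TransposedOperator.
Variables (R : realType) (gamma : R) (B : seq (R * R)) (Rr al s : R).
Hypotheses (gamma_ge1 : 1 <= gamma) (B_ge : forall b, b \in B -> gamma <= b.1).
Hypotheses (al_ge0 : 0 <= al) (s_ge0 : 0 <= s).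
Implicit Types (z : R * R) (o : option (R * R)) (phi psi : option (R * R) -> R).

(* [Some b] is the function z |-> |z + b|^(-2s), [None] the constant 1. *)
Definition gen z o : R := if o is Some b then hpow s (cadd z b) else 1.

(** Stable under c -> b + 1/c for |b| <= Rr: Re c >= 1 gives |1/c| <= 1, whence |b + 1/c|^2 <=
    2|b|^2 + 2|1/c|^2 <= 2 Rr^2 + 2. *)
Definition admissible o : Prop :=
  if o is Some b then gamma <= b.1 /\ sqmod b <= 2 * Rr ^+ 2 + 2 else True.

Definition weight o : R := if o is Some b then hpow s b else 1.

(** The reciprocal of the parameter, [None] being the parameter at infinity. *)
Definition node o : R * R := if o is Some b then cinv b else (0, 0).

Definition Top phi o : R :=
  weight o * (\sum_(b <- B | cmod b <= Rr) phi (Some (cadd b (node o)))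
              + al * phi None).

Lemma admissible_shift b o : b \in B -> cmod b <= Rr -> admissible o ->
  admissible (Some (cadd b (node o))).
Proof.
move=> bB bR ao; have bg := B_ge bB; split.
  case: o ao => [c [cg _]|_]; rewrite /cadd /node; last by rewrite addr0.
  have : 0 <= (cinv c).1 by apply: cinv_re_ge0; have := gamma_ge1; lra.
  by move: (cinv c) => d /= d0; lra.
apply: le_trans (sqmod_addl _ _) _; apply: lerD.
  by rewrite ler_pM2l // -cmod_sq ler_pXn2r ?nnegrE ?cmod_ge0 // (le_trans _ bR) ?cmod_ge0.
rewrite /node; case: o ao => [c [cg _]|_] /=; last by rewrite /sqmod /= expr0n /=; lra.
have c1 : 1 <= sqmod c by apply: sqmod_ge1; have := gamma_ge1; lra.
rewrite sqmod_cinv; last by lra.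
by have := invf_le1 (lt_le_trans ltr01 c1); rewrite c1; lra.
Qed.

Lemma weight_gt0 o : 0 < weight o.
Proof. by case: o => //= b; exact: hpow_gt0. Qed.

Lemma eq_Top phi psi o : admissible o ->
  (forall o, admissible o -> phi o = psi o) -> Top phi o = Top psi o.
Proof.
move=> ao h; rewrite /Top h //; congr (_ * (_ + _)).
rewrite big_seq_cond [RHS]big_seq_cond; apply: eq_bigr => b /andP[bB bR].
exact/h/admissible_shift.
Qed.

Lemma eq_iter_Top k phi psi o : admissible o ->
  (forall o, admissible o -> phi o = psi o) -> iter k Top phi o = iter k Top psi o.
Proof.
elim: k o => [|k IH] o ao h /=; first exact: h.
by apply: eq_Top => // o' ao'; exact: IH.
Qed.

Lemma le_Top phi psi o : admissible o ->
  (forall o, admissible o -> phi o <= psi o) -> Top phi o <= Top psi o.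
Proof.
move=> ao h; rewrite /Top ler_pM2l ?weight_gt0 //; apply: lerD; last first.
  by rewrite ler_wpM2l // h.
rewrite big_seq_cond [leRHS]big_seq_cond; apply: ler_sum => b /andP[bB bR].
exact/h/admissible_shift.
Qed.

Lemma le_iter_Top k phi psi o : admissible o ->
  (forall o, admissible o -> phi o <= psi o) -> iter k Top phi o <= iter k Top psi o.
Proof.
elim: k o => [|k IH] o ao h /=; first exact: h.
by apply: le_Top => // o' ao'; exact: IH.
Qed.

Lemma TopP c phi psi : Top (fun o => c * phi o + psi o) =
  (fun o => c * Top phi o + Top psi o).
Proof.
apply/funext => o; rewrite /Top big_split /= -mulr_sumr; ring.
Qed.

Lemma iter_TopP k c phi psi : iter k Top (fun o => c * phi o + psi o) =
  (fun o => c * iter k Top phi o + iter k Top psi o).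
Proof. by elim: k => [//|k IH] /=; rewrite IH TopP. Qed.

Lemma iter_Top0 k : iter k Top (fun=> 0) = (fun=> 0).
Proof.
(* Linearity at 0 = (-1) 0 + 0 reads T^k 0 = - T^k 0 + T^k 0. *)
have h := iter_TopP k (-1) (fun=> 0) (fun=> 0); apply/funext => o.
have := congr1 (@^~ o) h; rewrite /= mulr0 addr0 => ->; ring.
Qed.

Lemma iter_TopZ k c phi : iter k Top (fun o => c * phi o) =
  (fun o => c * iter k Top phi o).
Proof.
have := iter_TopP k c phi (fun=> 0); rewrite iter_Top0 => h.
transitivity (iter k Top (fun o => c * phi o + 0)); last first.
  by rewrite h; apply/funext => o; rewrite addr0.
by congr iter; apply/funext => o; rewrite addr0.
Qed.

Lemma iter_Top_sum k (l : seq (R * R)) (P : pred (R * R)) c phi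
    (F : R * R -> option (R * R) -> R) (C : R * R -> R) o :
  iter k Top (fun o => \sum_(b <- l | P b) F b o * C b + c * phi o) o =
  \sum_(b <- l | P b) iter k Top (F b) o * C b + c * iter k Top phi o.
Proof.
elim: l => [|b l IH].
  rewrite big_nil add0r -[RHS](congr1 (@^~ o) (iter_TopZ k c phi)); congr (iter k Top _ o).
  by apply/funext => o'; rewrite big_nil add0r.
rewrite big_cons; case: ifPn => Pb; last first.
  rewrite -IH; congr (iter k Top _ o).
  by apply/funext => o'; rewrite big_cons (negPf Pb).
rewrite -addrA -IH mulrC -[_ + _](congr1 (@^~ o) (iter_TopP k (C b) (F b) _)).
congr (iter k Top _ o); apply/funext => o'.
by rewrite big_cons Pb -addrA mulrC.
Qed.

Lemma adm_gt0 z b : 0 <= z.1 -> gamma <= b.1 -> 0 < sqmod (cadd z b).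
Proof. by move=> z0 hb; apply: sqmod_gt0; rewrite /cadd /=; have := gamma_ge1; lra. Qed.

Lemma adm_ge1 z b : 0 <= z.1 -> gamma <= b.1 -> 1 <= sqmod (cadd z b).
Proof. by move=> z0 hb; apply: sqmod_ge1; rewrite /cadd /=; have := gamma_ge1; lra. Qed.

Lemma theta_re_ge0 z b : 0 <= z.1 -> gamma <= b.1 -> 0 <= (theta b z).1.
Proof. by move=> z0 hb; apply: cinv_re_ge0; rewrite /cadd /=; have := gamma_ge1; lra. Qed.

Lemma LopE f z : 0 <= z.1 -> Lop B Rr al s f z =
  \sum_(b <- B | cmod b <= Rr) f (theta b z) * hpow s (cadd z b) + al * f (0, 0).
Proof.
move=> z0; rewrite /Lop; congr (_ + _).
rewrite big_seq_cond [RHS]big_seq_cond; apply: eq_bigr => b /andP[bB bR].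
by rewrite hpow_cmod // adm_gt0 // B_ge.
Qed.

Lemma gen_transfer z o : 0 <= z.1 -> admissible o ->
  \sum_(b <- B | cmod b <= Rr) gen (theta b z) o * hpow s (cadd z b)
  + al * gen (0, 0) o = Top (gen z) o.
Proof.
move=> z0; case: o => [c [cg _]|_]; rewrite /Top /=; last first.
  rewrite mul1r; congr (_ + _); apply: eq_bigr => b _; rewrite mul1r.
  by congr (hpow s _); rewrite /cadd /= !addr0.
rewrite mulrDr mulr_sumr mulr1 [al * _]mulrC; congr (_ + _ * _); last first.
  by congr (hpow s _); rewrite /cadd /= !add0r -surjective_pairing.
rewrite big_seq_cond [RHS]big_seq_cond; apply: eq_bigr => b /andP[bB bR].
have bg := B_ge bB; have cp : 0 < sqmod c by apply: sqmod_gt0; have := gamma_ge1; lra.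
have h1 := adm_gt0 z0 bg.
apply: hpowM => //.
- by apply: adm_gt0 => //; exact: theta_re_ge0.
- apply: adm_gt0 => //; rewrite /cadd /= -[leLHS]addr0 lerD //.
  by apply: cinv_re_ge0; have := gamma_ge1; lra.
- exact: sqmod_theta.
Qed.

Lemma gen_gt0 z o : 0 < gen z o.
Proof. by case: o => //= b; exact: hpow_gt0. Qed.

Lemma gen_le1 z o : 0 <= z.1 -> admissible o -> gen z o <= 1.
Proof.
by move=> z0; case: o => //= b [bg _]; apply: hpow_le1 => //; exact: adm_ge1.
Qed.

(** Evaluated at a real point whose square bounds |z + b|^2 for |z|^2 <= M and b admissible. *)
Definition gen_lb M : R := hpow s (Num.sqrt (2 * M + 2 * (2 * Rr ^+ 2 + 2)), 0).

Lemma gen_lb_gt0 M : 0 < gen_lb M.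
Proof. exact: hpow_gt0. Qed.

Lemma gen_lb_le1 M : 0 <= M -> gen_lb M <= 1.
Proof.
move=> M0; apply: hpow_le1 => //; rewrite /sqmod /= sqr_sqrtr.
  by rewrite expr0n /= addr0; have := sqr_ge0 Rr; lra.
by have := sqr_ge0 Rr; lra.
Qed.

Lemma gen_ge M z o : 0 <= z.1 -> sqmod z <= M -> admissible o ->
  gen_lb M <= gen z o.
Proof.
move=> z0 zM; have M0 : 0 <= M := le_trans (sqmod_ge0 _) zM.
case: o => [b [bg bQ]|_] /=; last exact: gen_lb_le1.
apply: hpow_le => //; first exact: adm_gt0.
rewrite [leRHS]/sqmod /= sqr_sqrtr; last by have := sqr_ge0 Rr; lra.
by rewrite expr0n /= addr0; apply: le_trans (sqmod_addl _ _) _; lra.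
Qed.

(** The constant 1 is the generator at [None]. An outermost step of L becomes an innermost step of
    T, by [gen_transfer] and the linearity of T^k. *)
Lemma iter_Lop1 k z : 0 <= z.1 ->
  iter k (Lop B Rr al s) (fun=> 1) z = iter k Top (gen z) None.
Proof.
elim: k z => [//|k IH] z z0; rewrite iterS LopE // iterSr.
rewrite -(eq_iter_Top k (o:=None) I (fun o ao => gen_transfer (o:=o) z0 ao)).
rewrite iter_Top_sum IH //; congr (_ + _).
rewrite big_seq_cond [RHS]big_seq_cond; apply: eq_bigr => b /andP[bB bR].
by rewrite IH // theta_re_ge0 // B_ge.
Qed.

End TransposedOperator.

(** * Nearly additive and nearly geometric sequences *)

Section QuasiGeometric.
Variable R : realType.

(** Comparing b (j k) with j b k and with k b j gives (b j - C)/j <= (b k + C)/k for all positive j,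
    k. Any l separating the two families works; the supremum of the left sides is one, so no limit
    is taken. *)
Lemma quasi_additive (b : nat -> R) (C : R) :
  (forall j k, `|b (j + k)%N - b j - b k| <= C) ->
  exists l, forall k, `|b k - k%:R * l| <= C.
Proof.
move=> qa.
have C0 : 0 <= C by apply: le_trans (qa 0%N 0%N).
have mulb j k : `|b (j.+1 * k)%N - j.+1%:R * b k| <= j.+1%:R * C.
  elim: j => [|j IH]; first by rewrite !mul1r mul1n subrr normr0.
  have := qa k (j.+1 * k)%N; rewrite -mulSn; move: IH.
  rewrite -(natr1 j.+1) !ler_norml => /andP[h1 h2] /andP[h3 h4].
  by apply/andP; split; lra.
have cross j k : (b j.+1 - C) / j.+1%:R <= (b k.+1 + C) / k.+1%:R.
  rewrite ler_pdivrMr ?ltr0Sn // mulrAC ler_pdivlMr ?ltr0Sn //.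
  have := mulb k j.+1; have := mulb j k.+1; rewrite mulnC.
  by rewrite !ler_norml => /andP[h1 h2] /andP[h3 h4]; lra.
pose E := [set (b j.+1 - C) / j.+1%:R | j in [set: nat]].
have E0 : E !=set0 by exists ((b 1%N - C) / 1); exists 0%N.
have Eub k : ubound E ((b k.+1 + C) / k.+1%:R) by move=> _ [j _ <-].
exists (sup E) => -[|k].
  (* For k = 0 the hypothesis at 0, 0 is the bound |b 0| <= C. *)
  by rewrite mul0r subr0; have := qa 0%N 0%N; rewrite subrr sub0r normrN.
have h1 : sup E <= (b k.+1 + C) / k.+1%:R by exact: ge_sup.
have h2 : (b k.+1 - C) / k.+1%:R <= sup E.
  apply: ub_le_sup; last by exists k.
  by exists ((b 1%N + C) / 1%:R); exact: Eub.
move: h1 h2; rewrite ler_pdivlMr ?ltr0Sn // ler_pdivrMr ?ltr0Sn // => h1 h2.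
by rewrite ler_norml; apply/andP; split; lra.
Qed.

Lemma quasi_geometric (S : nat -> R) (c : R) : 0 < c ->
  (forall k, 0 < S k) ->
  (forall j k, c * (S j * S k) <= S (j + k)%N) ->
  (forall j k, S (j + k)%N <= c^-1 * (S j * S k)) ->
  exists2 r, 0 < r & forall k, c * S k <= r ^+ k /\ r ^+ k <= c^-1 * S k.
Proof.
move=> c0 S0 Slo Sup.
have [l hl] : exists l, forall k, `|ln (S k) - k%:R * l| <= - ln c.
  apply: quasi_additive => j k; rewrite ler_norml opprK.
  have SS : 0 < S j * S k by rewrite mulr_gt0.
  have := Slo j k; rewrite -ler_ln ?posrE ?mulr_gt0 // !lnM ?posrE // => h1.
  have := Sup j k; rewrite -ler_ln ?posrE ?mulr_gt0 ?invr_gt0 //.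
  rewrite !lnM ?posrE ?invr_gt0 // lnV ?posrE // => h2.
  by apply/andP; split; lra.
exists (expR l) => [|k]; first exact: expR_gt0.
have := hl k; rewrite -expRM_natl ler_norml opprK => /andP[h1 h2].
rewrite -[c * S k]lnK ?posrE ?mulr_gt0 // -[_^-1 * S k]lnK ?posrE ?mulr_gt0 ?invr_gt0 //.
rewrite !ler_expR !lnM ?posrE ?invr_gt0 // lnV ?posrE //.
by split; lra.
Qed.

End QuasiGeometric.

(** * Positivity and growth of the iterates of L *)

Section Growth.
Variables (R : realType) (gamma : R) (B : seq (R * R)) (Rr al s : R).
Hypotheses (gamma_ge1 : 1 <= gamma) (B_ge : forall b, b \in B -> gamma <= b.1).
Hypotheses (al_ge0 : 0 <= al) (s_ge0 : 0 <= s).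
Hypothesis nontrivial : 0 < al \/ exists b, b \in B /\ cmod b <= Rr.
Variables (A : set (R * R)) (M : R).
Hypotheses (A0 : A (0, 0)) (A_re : forall z, A z -> 0 <= z.1)
  (A_bd : forall z, A z -> sqmod z <= M)
  (A_theta : forall b z, b \in B -> A z -> A (theta b z)).
Implicit Types (z : R * R) (f g : R * R -> R).

Let L := Lop B Rr al s.
Let T := Top B Rr al s.
Let c := gen_lb Rr s M.

Lemma LopP (a : R) f g : L (fun z => a * f z + g z) = (fun z => a * L f z + L g z).
Proof.
apply/funext => z; rewrite /L /Lop; under eq_bigr do rewrite mulrDl -mulrA.
by rewrite big_split /= -mulr_sumr; ring.
Qed.

Lemma iter_LopP k (a : R) f g : iter k L (fun z => a * f z + g z) =
  (fun z => a * iter k L f z + iter k L g z).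
Proof. by elim: k => [//|k IH] /=; rewrite IH LopP. Qed.

Lemma iter_Lop0 k : iter k L (fun=> 0) = (fun=> 0).
Proof.
have h := iter_LopP k (-1) (fun=> 0) (fun=> 0); apply/funext => z.
have := congr1 (@^~ z) h; rewrite /= mulr0 addr0 => ->; ring.
Qed.

Lemma iter_LopZ k (a : R) f z : iter k L (fun z => a * f z) z = a * iter k L f z.
Proof.
have := congr1 (@^~ z) (iter_LopP k a f (fun=> 0)); rewrite iter_Lop0 addr0 => <-.
by congr (iter k L _ z); apply/funext => u; rewrite addr0.
Qed.

Lemma le_Lop f g z : A z -> (forall z, A z -> f z <= g z) -> L f z <= L g z.
Proof.
move=> Az h; rewrite /L !(LopE _ _ _ gamma_ge1 B_ge) ?A_re //.
apply: lerD; last by rewrite ler_wpM2l // h.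
rewrite big_seq_cond [leRHS]big_seq_cond; apply: ler_sum => b /andP[bB bR].
by rewrite ler_pM2r ?hpow_gt0 // h //; apply: A_theta.
Qed.

Lemma le_iter_Lop k f g z : A z -> (forall z, A z -> f z <= g z) ->
  iter k L f z <= iter k L g z.
Proof.
elim: k z => [|k IH] z Az h /=; first exact: h.
by apply: le_Lop => // u Au; exact: IH.
Qed.

Lemma Lop_ge_branch f z b : b \in B -> cmod b <= Rr -> A z ->
  (forall z, A z -> 0 <= f z) -> f (theta b z) * hpow s (cadd z b) <= L f z.
Proof.
move=> bB bR Az h; rewrite /L (LopE _ _ _ gamma_ge1 B_ge) ?A_re //.
rewrite big_mkcond (big_rem b) //= bR -addrA ler_wpDr //.
rewrite addr_ge0 ?mulr_ge0 ?h // big_seq sumr_ge0 // => b' bB'.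
case: ifPn => // bR'; rewrite mulr_ge0 ?(ltW (hpow_gt0 _ _)) // h //.
by apply: A_theta => //; exact: mem_rem bB'.
Qed.

Lemma Lop_ge_const f z : A z -> (forall z, A z -> 0 <= f z) -> al * f (0, 0) <= L f z.
Proof.
move=> Az h; rewrite /L (LopE _ _ _ gamma_ge1 B_ge) ?A_re // lerDr.
rewrite big_seq_cond sumr_ge0 // => b /andP[bB bR].
by rewrite mulr_ge0 ?(ltW (hpow_gt0 _ _)) // h //; apply: A_theta.
Qed.

Lemma Lop_gt0 f z : A z -> (forall z, A z -> 0 < f z) -> 0 < L f z.
Proof.
move=> Az h; have h' u : A u -> 0 <= f u by move=> /h /ltW.
case: nontrivial => [al0|[b [bB bR]]].
  by apply: lt_le_trans (Lop_ge_const Az h'); rewrite mulr_gt0 ?h.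
apply: lt_le_trans (Lop_ge_branch bB bR Az h').
by rewrite mulr_gt0 ?hpow_gt0 // h //; apply: A_theta.
Qed.

Lemma iter_Lop_gt0 k f z : A z -> (forall z, A z -> 0 < f z) -> 0 < iter k L f z.
Proof.
elim: k z => [|k IH] z Az h /=; first exact: h.
by apply: Lop_gt0 => // u Au; exact: IH.
Qed.

Lemma iter_Lop1_le k z : A z -> iter k L (fun=> 1) z <= iter k T (fun=> 1) None.
Proof.
move=> Az; rewrite /L (iter_Lop1 _ _ _ gamma_ge1 B_ge) ?A_re //.
by apply: (le_iter_Top _ gamma_ge1 B_ge) => // o; apply: (gen_le1 gamma_ge1) => //; exact: A_re.
Qed.

(** With [iter_Lop1_le] this traps L^k 1 on A between c times and once a number independent of the
    point. *)
Lemma iter_Lop1_ge k z : A z -> c * iter k T (fun=> 1) None <= iter k L (fun=> 1) z.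
Proof.
move=> Az; rewrite /L (iter_Lop1 _ _ _ gamma_ge1 B_ge) ?A_re //.
rewrite -[leLHS](congr1 (@^~ None) (iter_TopZ B Rr al s k c (fun=> 1))).
apply: (le_iter_Top _ gamma_ge1 B_ge) => // o ao; rewrite mulr1.
by apply: (gen_ge gamma_ge1) => //; [exact: A_re | exact: A_bd].
Qed.

Lemma spectral_growth : exists2 r, 0 < r & forall k,
  c * iter k L (fun=> 1) (0, 0) <= r ^+ k /\
  r ^+ k <= c^-1 * iter k L (fun=> 1) (0, 0).
Proof.
have c0 : 0 < c by exact: gen_lb_gt0.
pose S k := iter k L (fun=> 1) (0, 0).
have S0 k : 0 < S k by apply: iter_Lop_gt0.
have aS k : S k <= iter k T (fun=> 1) None by exact: iter_Lop1_le.
have Sa k : iter k T (fun=> 1) None <= c^-1 * S k.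
  by rewrite mulrC ler_pdivlMr // mulrC iter_Lop1_ge.
(* L^(j+k) 1 = L^j (L^k 1), and on A the inner function lies between two constants, which L^j lets
   through; these constants are S k up to a factor c. *)
apply: (@quasi_geometric R S c) => // j k; rewrite [S (j + k)%N]/S iterD.
  apply: (@le_trans _ _ (c * iter k T (fun=> 1) None * S j)).
    by rewrite [S j * _]mulrC mulrA ler_pM2r // ler_pM2l.
  rewrite -iter_LopZ; apply: le_iter_Lop => // z Az.
  by rewrite mulr1; exact: iter_Lop1_ge.
apply: (@le_trans _ _ (iter k T (fun=> 1) None * S j)).
  rewrite -iter_LopZ; apply: le_iter_Lop => // z Az.
  by rewrite mulr1; exact: iter_Lop1_le.
by rewrite [S j * _]mulrC mulrA ler_pM2r.
Qed.

End Growth.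

(** * Limits along an ultrafilter *)

Section UltraLimits.

Lemma ultrafilter_infty : exists2 F : set_system nat, UltraFilter F & \oo `<=` F.
Proof.
by have [F [uF hF]] := ultraFilterLemma eventually_filter; exists F.
Qed.

(** A cluster point of the image of an ultrafilter is a limit: if the preimage of a neighbourhood
    were not in F, that of its complement would be, against clustering. *)
Lemma ultra_compact_cvg (X : topologicalType) (A : set X) (F : set_system nat)
    (u : nat -> X) : UltraFilter F -> compact A -> (forall n, A (u n)) ->
  exists2 p, A p & u @ F --> p.
Proof.
move=> uF cA uA; have uFA : F (u @^-1` A) by apply: filterE => n; exact: uA.
have [p [Ap clp]] := cA (u @ F) _ uFA.
exists p => // V Vp; have [//|FnV] := in_ultra_setVsetC (u @^-1` V) uF.
have : (u @ F) (~` V) by [].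
by move=> /clp /(_ Vp) [x [nVx Vx]].
Qed.

End UltraLimits.

(** * A positive functional that is an eigenvector of the adjoint of T *)

Section EigenFunctional.
Variables (R : realType) (gamma : R) (B : seq (R * R)) (Rr al s : R).
Hypotheses (gamma_ge1 : 1 <= gamma) (B_ge : forall b, b \in B -> gamma <= b.1).
Hypotheses (al_ge0 : 0 <= al) (s_ge0 : 0 <= s).
Implicit Types (phi psi : option (R * R) -> R).

Let T := Top B Rr al s.
Let adm := admissible gamma Rr.

Definition bounded_adm phi : Prop :=
  exists D, forall o, adm o -> `|phi o| <= D.

(** Linearity is asked only for functions bounded on admissible parameters, where the ultrafilter
    limit is known to exist. Monotonicity, used both ways, makes Lam blind to inadmissible
    parameters. *)
Definition positive_functional (Lam : (option (R * R) -> R) -> R) : Prop :=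
  (forall c phi psi, bounded_adm phi -> bounded_adm psi ->
     Lam (fun o => c * phi o + psi o) = c * Lam phi + Lam psi) /\
  (forall phi psi, bounded_adm phi -> bounded_adm psi ->
     (forall o, adm o -> phi o <= psi o) -> Lam phi <= Lam psi).

Lemma bounded_admP c phi psi : bounded_adm phi -> bounded_adm psi ->
  bounded_adm (fun o => c * phi o + psi o).
Proof.
move=> [D hD] [E hE]; exists (`|c| * D + E) => o ao.
by rewrite (le_trans (ler_normD _ _)) // normrM lerD ?ler_wpM2l ?hD ?hE.
Qed.

Lemma bounded_adm_cst c : bounded_adm (fun=> c).
Proof. by exists `|c|. Qed.

Lemma weight_le1 o : adm o -> weight s o <= 1.
Proof.
case: o => // b [bg _]; apply: hpow_le1 => //; apply: sqmod_ge1.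
exact: le_trans gamma_ge1 bg.
Qed.

Lemma iter_Top_norm k phi D o : adm o -> (forall o, adm o -> `|phi o| <= D) ->
  `|iter k T phi o| <= D * iter k T (fun=> 1) o.
Proof.
move=> ao hD; rewrite ler_norml -mulNr.
rewrite -[leLHS](congr1 (@^~ o) (iter_TopZ B Rr al s k (- D) (fun=> 1))).
rewrite -[X in _ && (_ <= X)](congr1 (@^~ o) (iter_TopZ B Rr al s k D (fun=> 1))).
apply/andP; split; apply: (le_iter_Top _ gamma_ge1 B_ge) => // o' ao';
  by rewrite mulr1; move: (hD _ ao'); rewrite ler_norml => /andP[].
Qed.

Lemma bounded_Top phi : bounded_adm phi -> bounded_adm (T phi).
Proof.
move=> [D hD]; exists (D * (\sum_(b <- B | cmod b <= Rr) 1 + al)) => o ao.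
have D0 : 0 <= D by apply: le_trans (hD None I).
apply: le_trans (iter_Top_norm 1 ao hD) _; rewrite /= ler_wpM2l //.
rewrite /T /Top mulr1 ler_piMl ?weight_le1 // addr_ge0 // sumr_ge0 //.
Qed.

Variables (r K : R).
Hypotheses (r_gt0 : 0 < r) (K_gt0 : 0 < K).
Hypothesis growth_le : forall k, iter k T (fun=> 1) None <= K * r ^+ k.
Hypothesis growth_ge : forall k, r ^+ k <= K * iter k T (fun=> 1) None.

Let e phi k := r ^- k * iter k T phi None.
Let mean phi (N : nat) := N.+1%:R^-1 * \sum_(k < N.+1) e phi k.

Let e_bound phi D k : (forall o, adm o -> `|phi o| <= D) -> `|e phi k| <= D * K.
Proof.
move=> hD; have D0 : 0 <= D by apply: le_trans (hD None I).
have rk : 0 < r ^+ k by rewrite exprn_gt0.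
rewrite normrM gtr0_norm ?invr_gt0 // mulrC ler_pdivrMr //.
apply: le_trans (iter_Top_norm k (o := None) I hD) _.
by rewrite -mulrA ler_wpM2l.
Qed.

Let mean_bound phi D N : (forall o, adm o -> `|phi o| <= D) -> `|mean phi N| <= D * K.
Proof.
move=> hD; rewrite normrM gtr0_norm ?invr_gt0 ?ltr0Sn // mulrC ler_pdivrMr ?ltr0Sn //.
apply: le_trans (ler_norm_sum _ _ _) _.
apply: (@le_trans _ _ (\sum_(k < N.+1) D * K)).
  by apply: ler_sum => k _; exact: e_bound.
by rewrite sumr_const card_ord mulr_natr.
Qed.

(** Since r^(-k) T^(k+1) is r times the normalised iterate of index k + 1, the difference of sums
    telescopes to r (e (N+1) - e 0), whose two terms are at most D K each; [harmonic N] is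
    1/(N+1). *)
Let mean_eigen phi D N : (forall o, adm o -> `|phi o| <= D) ->
  `|mean (T phi) N - r * mean phi N| <= 2 * r * D * K * harmonic N.
Proof.
move=> hD.
have -> : mean (T phi) N - r * mean phi N =
    N.+1%:R^-1 * (r * (e phi N.+1 - e phi 0%N)).
  rewrite /mean mulrCA -mulrBr; congr (_ * _).
  rewrite -(big_mkord xpredT (e (T phi))) -(big_mkord xpredT (e phi)).
  rewrite -(telescope_sumr (e phi)) // !mulr_sumr -sumrB.
  apply: eq_bigr => k _; rewrite /e -iterSr mulrBr; congr (_ - _).
  by rewrite exprS invfM !mulrA divff ?mul1r // gt_eqF.
rewrite normrM gtr0_norm ?invr_gt0 ?ltr0Sn // mulrC ler_pM2r ?invr_gt0 ?ltr0Sn //.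
rewrite normrM gtr0_norm // -!mulrA mulrCA ler_pM2l //.
apply: le_trans (ler_normB _ _) _; rewrite mulr_natl mulr2n.
by rewrite lerD ?e_bound.
Qed.

Lemma eigenfunctional : exists Lam : (option (R * R) -> R) -> R,
  [/\ positive_functional Lam, 0 < Lam (fun=> 1) &
      forall phi, bounded_adm phi -> Lam (T phi) = r * Lam phi].
Proof.
have [F uF ooF] := ultrafilter_infty.
have PF : ProperFilter F := ultra_proper.
(* One ultrafilter serves every phi, which makes Lam linear on bounded functions. *)
pose Lam phi := lim (mean phi @ F).
have cvgL phi : bounded_adm phi -> mean phi @ F --> Lam phi.
  move=> [D hD].
  have [| |p _ hp] := ultra_compact_cvg (A := `[- (D * K), D * K]) (u := mean phi) uF.
  - exact: segment_compact.
  - by move=> N /=; rewrite in_itv /= -ler_norml; exact: mean_bound.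
  - by rewrite /Lam (cvg_lim _ hp).
exists Lam; split.
- split.
    move=> c phi psi bphi bpsi; apply: cvg_lim => //.
    have -> : mean (fun o => c * phi o + psi o) =
        (fun N => c * mean phi N + mean psi N).
      apply/funext => N; rewrite /mean mulrCA -mulrDr [c * _]mulr_sumr -big_split /=.
      congr (_ * _); apply: eq_bigr => k _; rewrite /e /T.
      by rewrite (congr1 (@^~ None) (iter_TopP B Rr al s k c phi psi)) mulrDr mulrCA.
    by apply: cvgD; [apply: cvgMl_tmp; exact: cvgL | exact: cvgL].
  move=> phi psi bphi bpsi h; apply: ler_cvg_to (cvgL _ bphi) (cvgL _ bpsi) _.
  apply: filterE => N; rewrite /mean ler_pM2l ?invr_gt0 ?ltr0Sn //.
  apply: ler_sum => k _; rewrite /e ler_pM2l ?invr_gt0 ?exprn_gt0 //.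
  exact: (le_iter_Top _ gamma_ge1 B_ge).
(* By the lower growth bound every normalised iterate of 1 is at least 1/K, hence so is every
   mean. *)
- apply: (@lt_le_trans _ _ K^-1); first by rewrite invr_gt0.
  apply: ler_cvg_to (cvg_cst _) (cvgL _ (bounded_adm_cst 1)) _.
  apply: filterE => N; rewrite /mean mulrC ler_pdivlMr ?ltr0Sn //.
  rewrite mulr_natr -[in leLHS](card_ord N.+1) -sumr_const.
  apply: ler_sum => k _; rewrite /e mulrC ler_pdivlMr ?exprn_gt0 //.
  by rewrite mulrC ler_pdivrMr // mulrC.
- move=> phi bphi; have bT := bounded_Top bphi.
  have [D hD] := bphi.
  apply/eqP; rewrite -subr_eq0; apply/eqP.
  have c1 : (mean (T phi) N - r * mean phi N) @[N --> F] --> Lam (T phi) - r * Lam phi.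
    by apply: cvgB; [exact: cvgL | apply: cvgMl_tmp; exact: cvgL].
  have ch : 2 * r * D * K * harmonic N @[N --> F] --> 2 * r * D * K * 0.
    apply: cvgMl_tmp; apply: cvg_trans cvg_harmonic.
    exact: cvg_app.
  apply: (cvg_unique _ c1) => //.
  rewrite mulr0 in ch.
  apply: (@squeeze_cvgr _ F _ R (fun N => - (2 * r * D * K * harmonic N))
    (fun N => 2 * r * D * K * harmonic N)) => //.
    apply: filterE => N; rewrite -ler_norml; exact: mean_eigen.
  by rewrite -oppr0; apply: cvgN.
Qed.

End EigenFunctional.

(** * First-order Taylor estimates in one variable *)

Section MeanValue.
Variable R : realType.
Implicit Types (f g : R -> R).

Lemma is_derive_mul f g (x a b : R) : is_derive x 1 f a -> is_derive x 1 g b ->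
  is_derive x 1 (fun t => f t * g t) (a * g x + f x * b).
Proof.
move=> hf hg; apply: is_derive_eq (is_deriveM hf hg) _.
by rewrite /GRing.scale /= addrC [g x * a]mulrC.
Qed.

Lemma is_derive_add f g (x a b : R) : is_derive x 1 f a -> is_derive x 1 g b ->
  is_derive x 1 (fun t => f t + g t) (a + b).
Proof. by move=> hf hg; apply: is_derive_eq (is_deriveD hf hg) _. Qed.

(** Unordered endpoints treat increments of both signs at once. *)
Definition between (a b t : R) := a <= t <= b \/ b <= t <= a.

Lemma between_sub a b t u : between a b t -> between a t u -> between a b u.
Proof. by move=> [/andP[? ?]|/andP[? ?]] [/andP[? ?]|/andP[? ?]]; rewrite /between; lra. Qed.

Lemma between_dist a b t : between a b t -> `|t - a| <= `|b - a|.
Proof.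
by move=> [/andP[? ?]|/andP[? ?]];
  [rewrite !ger0_norm ?subr_ge0 //|rewrite !ler0_norm ?subr_le0 //]; lra.
Qed.

Lemma mean_value_bound f f1 a b K :
  (forall t, between a b t -> is_derive t 1 f (f1 t) /\ `|f1 t| <= K) ->
  `|f b - f a| <= K * `|b - a|.
Proof.
wlog ab : a b / a <= b => [hw|] h.
  have [ab|/ltW ba] := leP a b; first exact: hw.
  rewrite distrC [`|b - a|]distrC; apply: hw => // t ht; apply: h.
  by case: ht; [right|left].
have d t : t \in `[a, b] -> is_derive t 1 f (f1 t) /\ `|f1 t| <= K.
  by rewrite in_itv /= => ht; apply: h; left.
have [||c cab ->] := @MVT_segment R f f1 a b ab.
- by move=> t /subset_itv_oo_cc /d[].
- by apply: derivable_within_continuous => t /d[[]].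
- by rewrite normrM ler_wpM2r //; have [] := d c cab.
Qed.

(** The mean value bound used twice: t -> f t - f1 a t has derivative f1 t - f1 a, itself at most K
    |t - a|. The factor 1/2 is given up. *)
Lemma taylor1_bound f f1 f2 a b K :
  (forall t, between a b t -> is_derive t 1 f (f1 t)) ->
  (forall t, between a b t -> is_derive t 1 f1 (f2 t) /\ `|f2 t| <= K) ->
  `|f b - f a - (b - a) * f1 a| <= K * (b - a) ^+ 2.
Proof.
move=> h1 h2.
have -> : f b - f a - (b - a) * f1 a =
    (f b + - f1 a * b) - (f a + - f1 a * a) by ring.
rewrite -[(b - a) ^+ 2]ger0_norm ?sqr_ge0 // normrX expr2 mulrA.
apply: (@mean_value_bound (fun t => f t + - f1 a * t) (fun t => f1 t - f1 a)).
move=> t ht; split.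
  apply: is_derive_add; first exact: h1.
  apply: is_derive_eq (is_derive_mul (is_derive_cst (- f1 a) t 1) (is_derive_id t 1)) _.
  by rewrite mul0r add0r mulr1.
apply: le_trans (mean_value_bound (f := f1) (f1 := f2) (K := K) _) _.
  by move=> u hu; apply: h2; exact: between_sub ht hu.
have K0 : 0 <= K by apply: le_trans (h2 a _).2 => //; rewrite /between; lra.
by rewrite ler_wpM2l // between_dist.
Qed.

(** A converse to Taylor: unlike a limit of difference quotients, a quadratic remainder bound passes
    through a positive functional. *)
Lemma is_derive_of_quadratic f (x l K d : R) : 0 < d ->
  (forall t, `|t - x| < d -> `|f t - f x - (t - x) * l| <= K * (t - x) ^+ 2) ->
  is_derive x 1 f l.
Proof.
move=> d0 h.
suff hc : h^-1 *: ((f \o shift x) (h *: 1) - f x) @[h --> 0^'] --> l.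
  by split; [apply/cvg_ex; exists l | exact: cvg_lim].
apply/cvgrPdist_le => eps e0.
have K1 : 0 < `|K| + 1 by rewrite ltr_wpDl.
have de : 0 < Num.min d (eps / (`|K| + 1)) by rewrite lt_min d0 divr_gt0.
near=> t.
have t0 : t != 0 by near: t; exact: nbhs_dnbhs_neq.
have : `|t| < Num.min d (eps / (`|K| + 1)).
  near: t; apply: dnbhs0_lt; exact: de.
rewrite lt_min => /andP[td te].
have := h (t + x); rewrite addrK => /(_ td) ht.
have nt : 0 < `|t| by rewrite normr_gt0.
rewrite /= distrC /GRing.scale /= mulr1.
have -> : t^-1 * (f (t + x) - f x) - l = t^-1 * (f (t + x) - f x - t * l).
  by rewrite [RHS]mulrBr mulKf.
rewrite normrM normfV mulrC ler_pdivrMr //; apply: le_trans ht _.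
rewrite -[t ^+ 2]ger0_norm ?sqr_ge0 // normrX expr2 mulrA ler_wpM2r //.
apply: (@le_trans _ _ ((`|K| + 1) * `|t|)).
  by rewrite ler_wpM2r //; have := ler_norm K; lra.
by rewrite mulrC -ler_pdivlMr // ltW.
Unshelve. all: by end_near.
Qed.

End MeanValue.

(** * Partial derivatives of all orders of |u|^(-2s) *)

Section RationalTerms.
Variable R : realType.
Implicit Types (u z p : R * R) (d : bool).

Definition along d p (t : R) : R * R := if d then (p.1, t) else (t, p.2).

Definition coord d p : R := if d then p.2 else p.1.

Lemma along_coord d p : along d p (coord d p) = p.
Proof. by case: d; rewrite /along /coord -surjective_pairing. Qed.

Lemma coord_along d p t : coord d (along d p t) = t.
Proof. by case: d. Qed.

Lemma along_along d p t t' : along d (along d p t) t' = along d p t'.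
Proof. by case: d. Qed.

Inductive rterm := TC of R | TX | TY | TA of rterm & rterm | TM of rterm & rterm.

(* [TX] and [TY] stand for x/|u|^2 and y/|u|^2: these have partial derivatives
   polynomial in themselves, so the functions |u|^(-2s) P(X, Y) are stable. *)
Fixpoint ev (t : rterm) u : R :=
  match t with
  | TC c => c
  | TX => u.1 / sqmod u
  | TY => u.2 / sqmod u
  | TA t1 t2 => ev t1 u + ev t2 u
  | TM t1 t2 => ev t1 u * ev t2 u
  end.

Fixpoint dterm d (t : rterm) : rterm :=
  match t with
  | TC c => TC 0
  | TX => if d then TM (TC (-2)) (TM TX TY)
          else TA (TM TY TY) (TM (TC (-1)) (TM TX TX))
  | TY => if d then TA (TM TX TX) (TM (TC (-1)) (TM TY TY))
          else TM (TC (-2)) (TM TX TY)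
  | TA t1 t2 => TA (dterm d t1) (dterm d t2)
  | TM t1 t2 => TA (TM (dterm d t1) t2) (TM t1 (dterm d t2))
  end.

Lemma sqmod_derive d u :
  is_derive (coord d u) 1 (fun t => sqmod (along d u t)) (2 * coord d u).
Proof.
have sq (x : R) : is_derive x 1 (fun t : R => t ^+ 2) (2 * x).
  under [fun t : R => _]funext do rewrite expr2.
  apply: is_derive_eq (is_derive_mul (is_derive_id x 1) (is_derive_id x 1)) _.
  by ring.
case: d; rewrite /coord /along /sqmod /=.
  exact: is_derive_eq (is_derive_add (is_derive_cst (u.1 ^+ 2) u.2 1) (sq u.2)) (add0r _).
exact: is_derive_eq (is_derive_add (sq u.1) (is_derive_cst (u.2 ^+ 2) u.1 1)) (addr0 _).
Qed.

Lemma inv_sqmod_derive d u : 0 < u.1 ->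
  is_derive (coord d u) 1 (fun t => (sqmod (along d u t))^-1)
    (- (2 * coord d u) / sqmod u ^+ 2).
Proof.
move=> u0; have h0 : sqmod u != 0 by rewrite gt_eqF // sqmod_gt0.
have hs := sqmod_derive d u.
have := @is_deriveV R (fun t => sqmod (along d u t)) (coord d u) _ 1 _ hs.
rewrite along_coord => /(_ h0) hV; apply: is_derive_eq hV _.
by rewrite /GRing.scale /= !mulNr mulrC.
Qed.

Lemma ev_derive d (t : rterm) u : 0 < u.1 ->
  is_derive (coord d u) 1 (fun v => ev t (along d u v)) (ev (dterm d t) u).
Proof.
move=> u0; have h0 : u.1 ^+ 2 + u.2 ^+ 2 != 0 by rewrite gt_eqF // sqmod_gt0.
have hi := inv_sqmod_derive d u0.
elim: t => [c|||t1 IH1 t2 IH2|t1 IH1 t2 IH2] /=.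
- exact: is_derive_cst.
- case: d hi => hi; rewrite /= /coord in hi *.
    apply: is_derive_eq (is_derive_mul (is_derive_cst u.1 u.2 1) hi) _.
    by rewrite /= /sqmod /along /=; field.
  apply: is_derive_eq (is_derive_mul (is_derive_id u.1 1) hi) _.
  by rewrite /= /sqmod /along /=; field.
- case: d hi => hi; rewrite /= /coord in hi *.
    apply: is_derive_eq (is_derive_mul (is_derive_id u.2 1) hi) _.
    by rewrite /= /sqmod /along /=; field.
  apply: is_derive_eq (is_derive_mul (is_derive_cst u.2 u.1 1) hi) _.
  by rewrite /= /sqmod /along /=; field.
- exact: is_derive_add.
- apply: is_derive_eq (is_derive_mul IH1 IH2) _.
  by rewrite along_coord.
Qed.

(** Uniform in u because |x| and |y| are at most |u|^2 once |u| >= 1. *)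
Lemma ev_bound (t : rterm) : exists K, forall u, 1 <= u.1 -> `|ev t u| <= K.
Proof.
have lin (x N : R) : 1 <= N -> x ^+ 2 <= N -> `|x / N| <= 1.
  move=> N1 xN; rewrite normrM normfV [`|N|]ger0_norm ?ler_pdivrMr ?mul1r; try lra.
  by rewrite -ler_sqr ?nnegrE //; [rewrite real_normK ?num_real //; nra | lra].
elim: t => [c|||t1 [K1 h1] t2 [K2 h2]|t1 [K1 h1] t2 [K2 h2]] /=.
- by exists `|c|.
- by exists 1 => u /sqmod_ge1 h; apply: lin => //; rewrite lerDl sqr_ge0.
- by exists 1 => u /sqmod_ge1 h; apply: lin => //; rewrite lerDr sqr_ge0.
- by exists (K1 + K2) => u hu; apply: le_trans (ler_normD _ _) _; rewrite lerD ?h1 ?h2.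
- by exists (K1 * K2) => u hu; rewrite normrM ler_pM ?h1 ?h2.
Qed.

Variable s : R.
Hypothesis s_ge0 : 0 <= s.

Lemma hpow_derive d u : 0 < u.1 ->
  is_derive (coord d u) 1 (fun t => hpow s (along d u t))
    (hpow s u * (-2 * s * ev (if d then TY else TX) u)).
Proof.
move=> u0; have h0 : 0 < sqmod u by exact: sqmod_gt0.
have hl : is_derive (sqmod (along d u (coord d u))) 1 (@ln R) (sqmod u)^-1.
  by rewrite along_coord; exact: is_derive1_ln.
have h1 := @is_derive1_comp R (@ln R) (fun t => sqmod (along d u t)) _ _ _ hl
  (sqmod_derive d u).
have h2 := is_derive_mul (is_derive_cst (- s) (coord d u) 1) h1.
have -> : (fun t => hpow s (along d u t)) =
    expR \o (fun t => cst (- s) t * (@ln R \o (fun t => sqmod (along d u t))) t).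
  by apply/funext => t; rewrite /hpow /= mulNr.
apply: is_derive_eq (is_derive1_comp (is_derive_expR _) h2) _.
rewrite /= along_coord /hpow /cst [- s * ln _]mulNr; congr (_ * _).
by rewrite /coord; case: d {hl h1 h2} => /=; ring.
Qed.

Definition gterm (t : rterm) u : R := hpow s u * ev t u.

(** Product rule for |u|^(-2s) t: the logarithmic derivative of the first factor is -2s x/|u|^2 or
    -2s y/|u|^2. *)
Definition dgterm d (t : rterm) : rterm :=
  TA (TM (TM (TC (-2 * s)) (if d then TY else TX)) t) (dterm d t).

Lemma gterm_derive d t u : 0 < u.1 ->
  is_derive (coord d u) 1 (fun v => gterm t (along d u v)) (gterm (dgterm d t) u).
Proof.
move=> u0.
apply: is_derive_eq (is_derive_mul (hpow_derive d u0) (ev_derive d t u0)) _.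
by rewrite along_coord /gterm /=; case: d => /=; ring.
Qed.

Lemma gterm_bound t : exists K, forall u, 1 <= u.1 -> `|gterm t u| <= K.
Proof.
have [K hK] := ev_bound t; exists K => u hu.
rewrite normrM -[leRHS]mul1r ler_pM // ?hK //.
by rewrite gtr0_norm ?hpow_gt0 // hpow_le1 // sqmod_ge1.
Qed.

End RationalTerms.

(** * Continuity from a Lipschitz bound *)

Section LipschitzContinuity.
Variable R : realType.

Lemma lipschitz_continuous_within (A : set (R * R)) (f : R * R -> R) (K : R) :
  (forall z z', A z -> A z' ->
    `|f z' - f z| <= K * (`|z'.1 - z.1| + `|z'.2 - z.2|)) ->
  {within A, continuous f}.
Proof.
move=> hK; apply/subspace_continuousP => z Az; apply/cvgrPdist_le => eps e0.
have K1 : 0 < 2 * (`|K| + 1) by rewrite mulr_gt0 // ltr_wpDl.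
have d0 : 0 < eps / (2 * (`|K| + 1)) by rewrite divr_gt0.
rewrite near_withinE; near=> z' => Az'.
have : ball z (eps / (2 * (`|K| + 1))) z' by near: z'; exact: nbhsx_ballx.
move=> [/= b1 b2]; rewrite /ball /= in b1 b2.
apply: le_trans (hK z' z Az' Az) _.
apply: (@le_trans _ _ ((`|K| + 1) * (eps / (2 * (`|K| + 1)) + eps / (2 * (`|K| + 1))))).
  apply: (@le_trans _ _ ((`|K| + 1) * (`|z.1 - z'.1| + `|z.2 - z'.2|))).
    by rewrite ler_wpM2r ?addr_ge0 //; have := ler_norm K; lra.
  by rewrite ler_wpM2l ?addr_ge0 // lerD // ltW.
have nz : `|K| + 1 != 0 by rewrite gt_eqF // ltr_wpDl.
rewrite le_eqVlt; apply/orP; left; apply/eqP; field.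
by rewrite nz.
Unshelve. all: by end_near.
Qed.

End LipschitzContinuity.

(** * Differentiation under the functional *)

Section FunctionalDerivatives.
Variables (R : realType) (gamma Rr s : R).
Hypotheses (gamma_ge1 : 1 <= gamma) (s_ge0 : 0 <= s).
Variable Lam : (option (R * R) -> R) -> R.
Hypothesis LamP : positive_functional gamma Rr Lam.
Implicit Types (z p u : R * R) (d : bool) (t : rterm R).
Implicit Types (phi psi : option (R * R) -> R).

Let bnd := bounded_adm gamma Rr.
Let adm := admissible gamma Rr.

Lemma Lam_lin c phi psi : bnd phi -> bnd psi ->
  Lam (fun o => c * phi o + psi o) = c * Lam phi + Lam psi.
Proof. exact: LamP.1. Qed.

Lemma Lam0 : Lam (fun=> 0) = 0.
Proof.
have b0 := bounded_adm_cst gamma Rr 0.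
have := Lam_lin (-1) b0 b0.
have -> : (fun _ : option (R * R) => -1 * 0 + 0 : R) = (fun=> 0).
  by apply/funext => o; ring.
by move=> ->; ring.
Qed.

Lemma LamZ c phi : bnd phi -> Lam (fun o => c * phi o) = c * Lam phi.
Proof.
move=> b; have b0 := bounded_adm_cst gamma Rr 0.
rewrite -[RHS]addr0 -Lam0 -Lam_lin //; congr Lam.
by apply/funext => o; rewrite addr0.
Qed.

Lemma Lam_le phi psi : bnd phi -> bnd psi ->
  (forall o, adm o -> phi o <= psi o) -> Lam phi <= Lam psi.
Proof. exact: LamP.2. Qed.

Lemma Lam_leZ c c' phi psi : bnd phi -> bnd psi ->
  (forall o, adm o -> c * phi o <= c' * psi o) -> c * Lam phi <= c' * Lam psi.
Proof.
have bZ (a : R) f : bnd f -> bnd (fun o => a * f o).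
  move=> [D hD]; exists (`|a| * D) => o ao.
  by rewrite normrM ler_wpM2l // hD.
by move=> b b' h; rewrite -!LamZ //; apply: Lam_le => //; exact: bZ.
Qed.

Lemma Lam_norm phi D : (forall o, adm o -> `|phi o| <= D) ->
  `|Lam phi| <= D * Lam (fun=> 1).
Proof.
move=> h; have b : bnd phi by exists D.
have b1 := bounded_adm_cst gamma Rr 1.
rewrite -[Lam phi]mul1r ler_norml -mulNr; apply/andP; split;
  apply: Lam_leZ => // o ao; rewrite mul1r mulr1;
  by move: (h o ao); rewrite ler_norml => /andP[].
Qed.

Lemma along_re_between d p v w : between (coord d p) v w ->
  1 <= p.1 -> 1 <= (along d p v).1 -> 1 <= (along d p w).1.
Proof.
case: d; rewrite /along /coord //=.
by move=> [/andP[? ?]|/andP[? ?]]; lra.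
Qed.

Lemma gterm_derive_along d t p v : 1 <= (along d p v).1 ->
  is_derive v 1 (fun w => gterm s t (along d p w)) (gterm s (dgterm s d t) (along d p v)).
Proof.
move=> h; have := @gterm_derive R s d t (along d p v); rewrite coord_along.
under eq_fun do rewrite along_along; apply; lra.
Qed.

Lemma gterm_lipschitz d t : exists2 K, 0 <= K & forall p v, 1 <= p.1 -> 1 <= (along d p v).1 ->
  `|gterm s t (along d p v) - gterm s t p| <= K * `|v - coord d p|.
Proof.
have [K hK] := gterm_bound s_ge0 (dgterm s d t).
exists K => [|p v p1 v1]; first exact: le_trans (normr_ge0 _) (hK (1, 0) (lexx _)).
rewrite -[in gterm s t p](along_coord d p).
apply: (@mean_value_bound R (fun w => gterm s t (along d p w))
  (fun w => gterm s (dgterm s d t) (along d p w))) => w hw.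
have w1 := along_re_between hw p1 v1.
by split; [exact: gterm_derive_along | exact: hK].
Qed.

Lemma gterm_taylor d t : exists2 K, 0 <= K & forall p v, 1 <= p.1 -> 1 <= (along d p v).1 ->
  `|gterm s t (along d p v) - gterm s t p
    - (v - coord d p) * gterm s (dgterm s d t) p| <= K * (v - coord d p) ^+ 2.
Proof.
have [K hK] := gterm_bound s_ge0 (dgterm s d (dgterm s d t)).
exists K => [|p v p1 v1]; first exact: le_trans (normr_ge0 _) (hK (1, 0) (lexx _)).
rewrite -[in gterm s t p](along_coord d p) -[in gterm s (dgterm s d t) p](along_coord d p).
apply: (@taylor1_bound R (fun w => gterm s t (along d p w))
  (fun w => gterm s (dgterm s d t) (along d p w))
  (fun w => gterm s (dgterm s d (dgterm s d t)) (along d p w))) => w hw;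
  have w1 := along_re_between hw p1 v1.
  exact: gterm_derive_along.
by split; [exact: gterm_derive_along | exact: hK].
Qed.

(** The value c at [None] is 1 for the generators themselves and 0 for their derivatives, as
    [base_const] records. *)
Definition genT t (c : R) z (o : option (R * R)) : R :=
  if o is Some b then gterm s t (cadd z b) else c.

Definition average t c z : R := Lam (genT t c z).

Lemma re_shift z b : adm (Some b) -> 0 <= z.1 -> 1 <= (cadd z b).1.
Proof. by move=> [bg _] z0; rewrite /cadd /=; have := gamma_ge1; lra. Qed.

Lemma along_shift d z b v : cadd (along d z v) b = along d (cadd z b) (v + coord d b).
Proof. by case: d. Qed.

Lemma coord_shift d z b v : v + coord d b - coord d (cadd z b) = v - coord d z.
Proof. by case: d => /=; ring. Qed.

Lemma bounded_genT t c z : 0 <= z.1 -> bnd (genT t c z).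
Proof.
have [K hK] := gterm_bound s_ge0 t.
move=> z0; exists (Num.max K `|c|) => -[b|] ab /=; rewrite le_max ?lexx ?orbT //.
by rewrite hK // re_shift.
Qed.

Lemma average_lipschitz_along d t c : exists K, forall z v, 0 <= z.1 ->
  0 <= (along d z v).1 ->
  `|average t c (along d z v) - average t c z| <= K * `|v - coord d z|.
Proof.
have [K K0 hK] := gterm_lipschitz d t; exists (K * Lam (fun=> 1)) => z v z0 v0.
have -> : average t c (along d z v) - average t c z =
    Lam (fun o => -1 * genT t c z o + genT t c (along d z v) o).
  by rewrite Lam_lin ?mulN1r 1?addrC //; exact: bounded_genT.
rewrite mulrAC; apply: Lam_norm => -[b|] ab /=; last first.
  rewrite mulN1r addNr normr0 mulr_ge0 //.
rewrite mulN1r addrC along_shift.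
have := hK (cadd z b) (v + coord d b).
by rewrite coord_shift -along_shift; apply; exact: re_shift.
Qed.

(** The Taylor remainder has the same constant K for all parameters, so it survives Lam and gives a
    remainder with constant K Lam(1). *)
Lemma average_derive d t c z : 0 < z.1 ->
  is_derive (coord d z) 1 (fun v => average t c (along d z v))
    (average (dgterm s d t) 0 z).
Proof.
move=> z0; have [K K0 hK] := gterm_taylor d t.
have zz : 0 <= z.1 by exact: ltW.
(* Within distance Re z the line stays in Re >= 0, where all shifted points have real part at least
   1. *)
apply: (@is_derive_of_quadratic _ _ _ _ (K * Lam (fun=> 1)) z.1) => // v hv.
have v0 : 0 <= (along d z v).1.
  case: d {hK} hv; rewrite /along /coord /= ?ltr_norml => // /andP[? ?]; lra.
have -> : average t c (along d z v) - average t c (along d z (coord d z))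
    - (v - coord d z) * average (dgterm s d t) 0 z =
    Lam (fun o => - (v - coord d z) * genT (dgterm s d t) 0 z o +
      (-1 * genT t c z o + genT t c (along d z v) o)).
  rewrite along_coord Lam_lin; last first.
  - apply: bounded_admP; exact: bounded_genT.
  - exact: bounded_genT.
  by rewrite Lam_lin; [rewrite /average; ring|exact: bounded_genT..].
rewrite mulrAC; apply: Lam_norm => -[b|] ab /=; last first.
  rewrite mulr0 mulN1r addNr addr0 normr0 mulr_ge0 ?sqr_ge0 //.
have := hK (cadd z b) (v + coord d b).
rewrite coord_shift -along_shift => /(_ (re_shift ab zz) (re_shift ab v0)).
by apply: le_trans; rewrite le_eqVlt; apply/orP; left; apply/eqP; congr (`|_|); ring.
Qed.

Lemma average_lipschitz t c : exists K, forall z z', 0 <= z.1 -> 0 <= z'.1 ->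
  `|average t c z' - average t c z| <= K * (`|z'.1 - z.1| + `|z'.2 - z.2|).
Proof.
have [K1 h1] := average_lipschitz_along false t c.
have [K2 h2] := average_lipschitz_along true t c.
exists (Num.max K1 K2) => z z' z0 z0'.
have e1 := h1 z z'.1 z0 z0'.
have e2 := h2 (z'.1, z.2) z'.2 z0' z0'.
rewrite /along /coord /= -surjective_pairing in e1 e2.
apply: le_trans (ler_distD (average t c (z'.1, z.2)) _ _) _.
rewrite mulrDr addrC; apply: lerD.
  by apply: le_trans e1 _; rewrite ler_wpM2r // le_max lexx.
by apply: le_trans e2 _; rewrite ler_wpM2r // le_max lexx orbT.
Qed.

Lemma average_continuous (A : set (R * R)) t c : (forall z, A z -> 0 <= z.1) ->
  {within A, continuous (average t c)}.
Proof.
move=> A0; have [K hK] := average_lipschitz t c.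
by apply: (@lipschitz_continuous_within _ _ _ K) => z z' Az Az'; apply: hK; exact: A0.
Qed.

Lemma pdirE d (f : R * R -> R) p :
  pdir d f p = derive1 (fun v => f (along d p v)) (coord d p).
Proof. by case: d. Qed.

Lemma pderivableE d (f : R * R -> R) p :
  pderivable d f p = derivable (fun v => f (along d p v)) (coord d p) 1.
Proof. by case: d. Qed.

Lemma re_gt0_near d p : 0 < p.1 -> \forall v \near coord d p, 0 < (along d p v).1.
Proof.
case: d => p0; rewrite /along /coord /=; first exact: filterE.
exact: lt_nbhsr.
Qed.

Definition base_const (ds : seq bool) : R := if ds is [::] then 1 else 0.

Lemma pderiv_average (ds : seq bool) p : 0 < p.1 ->
  pderiv ds (average (TC 1) 1) p =
  average (foldr (dgterm s) (TC 1) ds) (base_const ds) p.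
Proof.
elim: ds p => [//|d ds IH] p p0; rewrite /= pdirE derive1E.
have h := average_derive d (foldr (dgterm s) (TC 1) ds) (base_const ds) p0.
rewrite -[RHS](@derive_val _ _ _ _ _ _ _ h).
(* A derivative is local and Re > 0 is open, so the formula for [ds] near p is enough. *)
apply: near_eq_derive.
by apply: filterS (re_gt0_near d p0) => v hv; exact: IH.
Qed.

Lemma pderivable_average (ds : seq bool) d p : 0 < p.1 ->
  pderivable d (pderiv ds (average (TC 1) 1)) p.
Proof.
move=> p0; rewrite pderivableE.
have h := average_derive d (foldr (dgterm s) (TC 1) ds) (base_const ds) p0.
apply: near_eq_derivable (@ex_derive _ _ _ _ _ _ _ h).
by apply: filterS (re_gt0_near d p0) => v hv; rewrite pderiv_average.
Qed.

End FunctionalDerivatives.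

(** * Harnack-type inequalities and second-derivative bounds *)

Section Estimates.
Variables (R : realType) (gamma Rr s : R).
Hypotheses (gamma_ge1 : 1 <= gamma) (s_ge0 : 0 <= s).
Variable Lam : (option (R * R) -> R) -> R.
Hypothesis LamP : positive_functional gamma Rr Lam.
Implicit Types (z p u : R * R).

Let adm := admissible gamma Rr.
Let w z := average s Lam (TC 1) 1 z.

Lemma genT1 z : genT s (TC 1) 1 z = gen s z.
Proof. by apply/funext => -[b|//]; rewrite /genT /gterm /= mulr1. Qed.

Lemma averageE z : w z = Lam (gen s z).
Proof. by rewrite /w /average genT1. Qed.

Lemma bounded_gen z : 0 <= z.1 -> bounded_adm gamma Rr (gen s z).
Proof. by rewrite -genT1; exact: bounded_genT. Qed.

Lemma gen_compare c z1 z2 : 0 <= z1.1 -> 0 <= z2.1 ->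
  (forall o, adm o -> c * gen s z1 o <= gen s z2 o) -> c * w z1 <= w z2.
Proof.
move=> h1 h2 h; rewrite !averageE -[leRHS]mul1r.
by apply: (Lam_leZ LamP) => [||o ao]; rewrite ?mul1r; [exact: bounded_gen..|exact: h].
Qed.

Lemma gen_compare_exp t z1 z2 : 0 <= t -> 0 <= z1.1 -> 0 <= z2.1 ->
  (forall b, gamma <= b.1 -> sqmod (cadd z2 b) <= sqmod (cadd z1 b) * expR t) ->
  w z1 * expR (- (s * t)) <= w z2.
Proof.
move=> t0 h1 h2 h; rewrite mulrC; apply: gen_compare => // -[b [bg _]|_] /=.
  rewrite mulrC; apply: hpow_le_exp => //; [exact: (adm_gt0 gamma_ge1)..|exact: h].
by rewrite mulr1 -[leRHS](@expR0 R) ler_expR oppr_le0 mulr_ge0.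
Qed.

Lemma average_decr_re x1 x2 y : 0 <= x1 -> x1 <= x2 -> w (x2, y) <= w (x1, y).
Proof.
move=> h1 h2; have h3 : 0 <= x2 by exact: le_trans h2.
rewrite -[leLHS]mul1r; apply: gen_compare => // -[b [bg _]|_]; rewrite mul1r //=.
apply: hpow_le => //; first exact: (adm_gt0 gamma_ge1).
by rewrite /sqmod /cadd /= lerD2r; have := gamma_ge1; nra.
Qed.

(** Since x1 + Re b >= gamma, a move by h to the right multiplies this real part by at most 1 +
    h/gamma <= exp(h/gamma), and the squared modulus by at most the square of that: hence the 2. *)
Lemma average_ge_re x1 x2 y : 0 <= x1 -> x1 <= x2 ->
  w (x1, y) * expR ((- 2 * s / gamma) * (x2 - x1)) <= w (x2, y).
Proof.
move=> h1 h2; have g0 : 0 < gamma by have := gamma_ge1; lra.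
have -> : (- 2 * s / gamma) * (x2 - x1) = - (s * (2 * ((x2 - x1) / gamma))) by ring.
have h3 : 0 <= x2 by exact: le_trans h2.
have d0 : 0 <= (x2 - x1) / gamma by apply: divr_ge0; [rewrite subr_ge0|exact: ltW].
apply: gen_compare_exp => // [|b bg]; first by rewrite mulr_ge0.
rewrite expRM_natl.
have e1 := expR_ge1Dx ((x2 - x1) / gamma).
have k0 : x2 + b.1 <= (x1 + b.1) * expR ((x2 - x1) / gamma).
  apply: (@le_trans _ _ ((x1 + b.1) * (1 + (x2 - x1) / gamma))).
    rewrite mulrDr mulr1 mulrA.
    suff : x2 - x1 <= (x1 + b.1) * (x2 - x1) / gamma by lra.
    by rewrite ler_pdivlMr // mulrC ler_wpM2r ?subr_ge0 //; lra.
  by rewrite ler_wpM2l //; lra.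
have k1 : 1 <= expR ((x2 - x1) / gamma) by lra.
rewrite /sqmod /cadd /= mulrDl -exprMn; apply: lerD.
  by rewrite ler_sqr ?nnegrE //; lra.
by rewrite ler_peMr ?sqr_ge0 // expr_ge1 //; lra.
Qed.

(** The function (a^2 + t^2) exp(-t/gamma) is nonincreasing, because 2 gamma t <= 2 a |t| <= a^2 +
    t^2. *)
Let vertical_up (a y1 y2 : R) : gamma <= a -> y1 <= y2 ->
  a ^+ 2 + y2 ^+ 2 <= (a ^+ 2 + y1 ^+ 2) * expR ((y2 - y1) / gamma).
Proof.
move=> ga y12; have g0 : 0 < gamma by have := gamma_ge1; lra.
pose f (t : R) := (a ^+ 2 + t ^+ 2) * expR (- gamma^-1 * t).
pose f1 (t : R) := (2 * t - gamma^-1 * (a ^+ 2 + t ^+ 2)) * expR (- gamma^-1 * t).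
have df (t : R) : is_derive t 1 f (f1 t).
  have h1 := is_derive_mul (is_derive_cst (- gamma^-1) t 1) (is_derive_id t 1).
  have h2 := @is_derive1_comp R expR (fun r => cst (- gamma^-1) r * id r) t _ _
    (is_derive_expR _) h1.
  have h3 := @sqmod_derive R true (a, t); rewrite /coord /along /sqmod /= in h3.
  apply: is_derive_eq (is_derive_mul h3 h2) _.
  by rewrite /f1 /cst /=; ring.
have [|c _ e] := @MVT_segment R f f1 y1 y2 y12 (fun t _ => df t).
  by apply: derivable_within_continuous => t _; have [] := df t.
have c0 : f1 c <= 0.
  rewrite /f1 pmulr_lle0 ?expR_gt0 // subr_le0 ler_pdivlMl //.
  by have := sqr_ge0 (a - c); have := sqr_ge0 c; nra.
have : f y2 <= f y1 by rewrite -subr_le0 e mulr_le0_ge0 // subr_ge0.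
rewrite /f -(ler_pM2r (expR_gt0 (gamma^-1 * y2))) -!mulrA -!expRD.
have -> : - gamma^-1 * y2 + gamma^-1 * y2 = 0 by ring.
have -> : - gamma^-1 * y1 + gamma^-1 * y2 = (y2 - y1) / gamma by ring.
by rewrite expR0 mulr1.
Qed.

Lemma average_vertical x y1 y2 : 0 <= x ->
  w (x, y1) <= w (x, y2) * expR ((s / gamma) * `|y1 - y2|).
Proof.
move=> x0; have g0 : 0 < gamma by have := gamma_ge1; lra.
have := @gen_compare_exp (`|y1 - y2| / gamma) (x, y1) (x, y2).
rewrite divr_ge0 ?(ltW g0) // => /(_ isT x0 x0) h.
have -> : s / gamma * `|y1 - y2| = s * (`|y1 - y2| / gamma) by ring.
rewrite -[leLHS]mulr1 -(@expR0 R) -[0 in leLHS](addNr (s * (`|y1 - y2| / gamma))) expRD mulrA.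
rewrite ler_pM2r ?expR_gt0 //; apply: h => b bg; rewrite /sqmod /cadd /=.
have ga : gamma <= x + b.1 by lra.
have [y12|/ltW y21] := leP y1 y2.
  rewrite distrC ger0_norm ?subr_ge0 //.
  have -> : y2 - y1 = (y2 + b.2) - (y1 + b.2) by ring.
  by apply: vertical_up; rewrite ?lerD2r.
rewrite ger0_norm ?subr_ge0 //.
(* Changing both signs reverses the order of the ordinates and keeps their squares. *)
have -> : y1 - y2 = - (y2 + b.2) - - (y1 + b.2) by ring.
rewrite -[(y2 + b.2) ^+ 2]sqrrN -[(y1 + b.2) ^+ 2]sqrrN.
by apply: vertical_up; rewrite ?lerN2 ?lerD2r.
Qed.

(** A horizontal move, then a vertical one. The corner (x1, y0) may leave the closure of U, but w is
    estimated on the whole half plane. The exponent 2|dx| + |dy| is at most sqrt 5 times the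
    distance by Cauchy-Schwarz. *)
Lemma average_harnack z0 z1 : 0 <= z0.1 -> 0 <= z1.1 ->
  w z0 <= w z1 * expR ((Num.sqrt 5 * s / gamma) * cmod (csub z1 z0)).
Proof.
case: z0 z1 => [x0 y0] [x1 y1] /= h0 h1.
have g0 : 0 < gamma by have := gamma_ge1; lra.
have hx : w (x0, y0) <= w (x1, y0) * expR (s / gamma * (2 * `|x1 - x0|)).
  have [x01|/ltW x10] := leP x0 x1.
    rewrite ger0_norm ?subr_ge0 //.
    have := average_ge_re y0 h0 x01.
    rewrite -(ler_pM2r (expR_gt0 (s / gamma * (2 * (x1 - x0))))) -[X in X <= _]mulrA -expRD.
    have -> : - 2 * s / gamma * (x1 - x0) + s / gamma * (2 * (x1 - x0)) = 0 by ring.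
    by rewrite expR0 mulr1.
  apply: le_trans (average_decr_re y0 h1 x10) _.
  rewrite -[leLHS]mulr1 ler_wpM2l //; last first.
    rewrite -[leLHS](@expR0 R) ler_expR mulr_ge0 ?mulr_ge0 ?invr_ge0 ?(ltW g0) //.
  have b1 := bounded_gen (z := (x1, y0)) h1.
  have b0 := bounded_adm_cst gamma Rr 0.
  rewrite averageE -(Lam0 LamP); apply: (Lam_le LamP) => // o _.
  exact/ltW/gen_gt0.
have w0 : 0 <= w (x1, y1).
  have b1 := bounded_gen (z := (x1, y1)) h1.
  have b0 := bounded_adm_cst gamma Rr 0.
  rewrite averageE -(Lam0 LamP); apply: (Lam_le LamP) => // o _.
  exact/ltW/gen_gt0.
apply: le_trans hx _.
apply: le_trans (ler_wpM2r (ltW (expR_gt0 _)) (average_vertical y0 y1 h1)) _.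
rewrite -[X in X <= _]mulrA -expRD ler_wpM2l // ler_expR.
have -> : Num.sqrt 5 * s / gamma * cmod (csub (x1, y1) (x0, y0)) =
  s / gamma * (Num.sqrt 5 * cmod (csub (x1, y1) (x0, y0))) by ring.
rewrite -mulrDr ler_wpM2l ?divr_ge0 ?(ltW g0) //.
rewrite -ler_sqr ?nnegrE ?addr_ge0 ?mulr_ge0 ?sqrtr_ge0 ?cmod_ge0 //.
rewrite exprMn sqr_sqrtr // cmod_sq /sqmod /csub /=.
rewrite distrC -[(x1 - x0) ^+ 2]real_normK ?num_real // -[(y1 - y0) ^+ 2]real_normK ?num_real //.
(* This square equals 5 (dx^2 + dy^2) - (2|dx| + |dy|)^2. *)
have := sqr_ge0 (2 * `|y1 - y0| - `|x1 - x0|); nra.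
Qed.

(** Here X^2 + Y^2 = 1/|u|^2, so this is Re u >= gamma rewritten: (X, Y) lies in the disc with
    diameter from 0 to 1/gamma on the real axis. The second-derivative bounds are estimates of
    quadratic forms on this disc. *)
Let rational_ineq u : gamma <= u.1 ->
  ev (TX R) u ^+ 2 + ev (TY R) u ^+ 2 <= gamma^-1 * ev (TX R) u.
Proof.
move=> gu; have g0 : 0 < gamma by have := gamma_ge1; lra.
have N0 : 0 < sqmod u by apply: sqmod_gt0; lra.
rewrite /= !expr_div_n -mulrDl -/(sqmod u) expr2 invfM mulrA divff ?gt_eqF // mul1r.
by rewrite mulrA ler_pdivlMr // mulVf ?gt_eqF // ler_pdivlMl // mulr1.
Qed.

(** The signs of the constants serve the parameter [None], whose generator is 1 with second
    derivative 0. *)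
Lemma average_second_compare c1 c2 d z : 0 <= z.1 -> 0 <= c1 -> 0 <= c2 ->
  (forall u, gamma <= u.1 ->
    - c1 <= ev (dgterm s d (dgterm s d (TC 1))) u <= c2) ->
  - c1 * w z <= average s Lam (dgterm s d (dgterm s d (TC 1))) 0 z /\
  average s Lam (dgterm s d (dgterm s d (TC 1))) 0 z <= c2 * w z.
Proof.
move=> z0 c10 c20 h.
pose t := dgterm s d (dgterm s d (TC 1)).
have b1 := bounded_gen z0.
have b2 := bounded_genT Rr gamma_ge1 s_ge0 t 0 z0.
have hh b : gamma <= b.1 -> - c1 * hpow s (cadd z b) <= gterm s t (cadd z b) /\
    gterm s t (cadd z b) <= c2 * hpow s (cadd z b).
  move=> bg; have /andP[l1 l2] : - c1 <= ev t (cadd z b) <= c2.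
    by apply: h; rewrite /cadd /=; lra.
  by rewrite /gterm ![_ * hpow _ _]mulrC !ler_pM2l ?hpow_gt0.
rewrite averageE -[average s Lam _ 0 z]mul1r; split;
  apply: (Lam_leZ LamP) => // -[b [bg _]|_]; rewrite /genT mul1r ?mulr1 ?oppr_le0 //.
  exact: (hh b bg).1.
exact: (hh b bg).2.
Qed.

Lemma average_xx z : 0 <= z.1 ->
  - (s / (4 * gamma ^+ 2 * (s + 1))) * w z <=
    average s Lam (dgterm s false (dgterm s false (TC 1))) 0 z /\
  average s Lam (dgterm s false (dgterm s false (TC 1))) 0 z <=
    (2 * s * (2 * s + 1) / gamma ^+ 2) * w z.
Proof.
have g0 : 0 < gamma by have := gamma_ge1; lra.
have s0 := s_ge0; have s1 : 0 < s + 1 by lra.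
move=> z0; apply: average_second_compare => //.
- by rewrite divr_ge0 // !mulr_ge0 ?sqr_ge0 // ltW.
- by rewrite divr_ge0 ?sqr_ge0 // !mulr_ge0 //; lra.
move=> u gu; have := rational_ineq gu.
rewrite /dgterm /=; move: (u.1 / sqmod u) (u.2 / sqmod u) => X Y h.
set v := (X in _ <= X <= _).
have -> : v = 2 * s * ((2 * s + 1) * X ^+ 2 - Y ^+ 2) by rewrite /v; ring.
set g := gamma^-1 in h *.
have gp : 0 < g by rewrite invr_gt0.
have X0 : 0 <= X by have := sqr_ge0 X; have := sqr_ge0 Y; nra.
have Xg : X <= g by have := sqr_ge0 Y; nra.
have -> : s / (4 * gamma ^+ 2 * (s + 1)) = 2 * s * (g ^+ 2 / (8 * (s + 1))).
  by rewrite /g; field; rewrite !gt_eqF.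
have -> : 2 * s * (2 * s + 1) / gamma ^+ 2 = 2 * s * ((2 * s + 1) * g ^+ 2).
  by rewrite /g; field; rewrite !gt_eqF.
have X2 : X ^+ 2 <= g ^+ 2 by rewrite ler_sqr ?nnegrE // ltW.
apply/andP; split; rewrite -?mulrN ler_wpM2l ?mulr_ge0 //; last first.
  have s21 : 0 <= 2 * s + 1 by lra.
  by have := ler_wpM2l s21 X2; have := sqr_ge0 Y; lra.
(* Replacing Y^2 by its bound g X - X^2 leaves (2s+2) X^2 - g X, with minimum -g^2/(8(s+1)) at X =
   g/(4(s+1)). *)
have : 0 <= 2 * (s + 1) * (X - g / (4 * (s + 1))) ^+ 2.
  by rewrite mulr_ge0 ?sqr_ge0 // mulr_ge0 // ltW.
have -> : 2 * (s + 1) * (X - g / (4 * (s + 1))) ^+ 2 =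
  (2 * s + 2) * X ^+ 2 - g * X + g ^+ 2 / (8 * (s + 1)).
  by field; rewrite gt_eqF.
by lra.
Qed.

Lemma average_yy z : 0 <= z.1 ->
  - (2 * s / gamma ^+ 2) * w z <=
    average s Lam (dgterm s true (dgterm s true (TC 1))) 0 z /\
  average s Lam (dgterm s true (dgterm s true (TC 1))) 0 z <=
    (2 * s * (2 * s + 1) / (4 * gamma ^+ 2)) * w z.
Proof.
have g0 : 0 < gamma by have := gamma_ge1; lra.
have s0 := s_ge0.
move=> z0; apply: average_second_compare => //.
- by rewrite divr_ge0 ?sqr_ge0 // mulr_ge0.
- by rewrite divr_ge0 ?mulr_ge0 ?sqr_ge0 //; lra.
move=> u gu; have := rational_ineq gu.
rewrite /dgterm /=; move: (u.1 / sqmod u) (u.2 / sqmod u) => X Y h.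
set v := (X in _ <= X <= _).
have -> : v = 2 * s * ((2 * s + 1) * Y ^+ 2 - X ^+ 2) by rewrite /v; ring.
set g := gamma^-1 in h *.
have gp : 0 < g by rewrite invr_gt0.
have X0 : 0 <= X by have := sqr_ge0 X; have := sqr_ge0 Y; nra.
have Xg : X <= g by have := sqr_ge0 Y; nra.
(* Y^2 <= g X - X^2, which is largest at X = g/2. *)
have Yg : Y ^+ 2 <= g ^+ 2 / 4 by have := sqr_ge0 (X - g / 2); nra.
have -> : 2 * s / gamma ^+ 2 = 2 * s * g ^+ 2.
  by rewrite /g; field; rewrite !gt_eqF.
have -> : 2 * s * (2 * s + 1) / (4 * gamma ^+ 2) = 2 * s * ((2 * s + 1) * (g ^+ 2 / 4)).
  by rewrite /g; field; rewrite !gt_eqF.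
have X2 : X ^+ 2 <= g ^+ 2 by rewrite ler_sqr ?nnegrE // ltW.
have s21 : 0 <= 2 * s + 1 by lra.
have := ler_wpM2l s21 Yg; have := mulr_ge0 s21 (sqr_ge0 Y); have := sqr_ge0 X => a1 a2 a3.
have -> : - (2 * s * g ^+ 2) = 2 * s * (- g ^+ 2) by ring.
apply/andP; split; rewrite ler_wpM2l ?mulr_ge0 //; lra.
Qed.

End Estimates.

(** * Limits of the coordinates *)

Section ProductLimits.
Variable R : realType.

Lemma cvg_fst_nbhs (p : R * R) : x.1 @[x --> p] --> p.1.
Proof.
by move=> V hV; exists (V, setT) => /=; [split=> //; exact: filterT|move=> x []].
Qed.

Lemma cvg_snd_nbhs (p : R * R) : x.2 @[x --> p] --> p.2.
Proof.
by move=> V hV; exists (setT, V) => /=; [split=> //; exact: filterT|move=> x []].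
Qed.

End ProductLimits.

(** * Contraction of the orbits and uniqueness of the eigenfunction *)

Section Uniqueness.
Variables (R : realType) (gamma : R) (B : seq (R * R)) (Rr al s : R).
Hypotheses (gamma_ge1 : 1 <= gamma) (B_ge : forall b, b \in B -> gamma <= b.1).
Hypotheses (al_ge0 : 0 <= al).
Hypothesis nontrivial : 0 < al \/ exists b, b \in B /\ cmod b <= Rr.
Variables (A : set (R * R)) (M : R).
Hypotheses (A0 : A (0, 0)) (A_re : forall z, A z -> 0 <= z.1)
  (A_bd : forall z, A z -> sqmod z <= M)
  (A_theta : forall b z, b \in B -> A z -> A (theta b z))
  (A_compact : compact A).
Implicit Types (z : R * R) (f g : R * R -> R).

Let L := Lop B Rr al s.

Lemma theta_dist b z z' : gamma <= b.1 -> A z -> A z' ->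
  sqmod (csub (theta b z) (theta b z')) =
  sqmod (csub z z') / (sqmod (cadd z b) * sqmod (cadd z' b)).
Proof.
move=> bg /A_re z0 /A_re z'0.
have := gt_eqF (adm_gt0 gamma_ge1 z0 bg); have := gt_eqF (adm_gt0 gamma_ge1 z'0 bg).
case: z z' b {z0 z'0 bg} => [x y] [x' y'] [b1 b2].
rewrite /theta /csub /cadd /cinv /sqmod /= => h1 h2.
by field; rewrite h1 h2.
Qed.

(** When gamma = 1, a point with |z + b| = 1 is possible and theta_b need not contract there. After
    one application the real part is at least some e > 0, hence |z + b|^2 >= 1 + e; so the second
    application is the one that contracts. *)
Lemma theta_contraction b : b \in B -> exists2 kap, 0 <= kap < 1 &
  forall z z', A z -> A z' ->
  sqmod (csub (theta b (theta b z)) (theta b (theta b z'))) <=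
  kap * sqmod (csub (theta b z) (theta b z')).
Proof.
move=> bB; have bg := B_ge bB; have M0 : 0 <= M := le_trans (sqmod_ge0 _) (A_bd A0).
(* Q bounds |z + b|^2 on A, so Re (1/(z + b)) = Re (z + b)/|z + b|^2 is at least 1/Q. *)
pose Q := 2 * M + 2 * sqmod b.
have b1 : 1 <= sqmod b by apply: sqmod_ge1; have := gamma_ge1; lra.
have Q0 : 0 < Q by rewrite /Q; lra.
have re_lb z : A z -> Q^-1 <= (theta b z).1.
  move=> Az; have z0 := A_re Az; rewrite /theta /cinv /= -/(sqmod (cadd z b)).
  have N0 := adm_gt0 gamma_ge1 z0 bg.
  rewrite ler_pdivlMr // mulrC ler_pdivrMr //.
  have := sqmod_addl z b; have := A_bd Az; have := gamma_ge1.
  by rewrite /Q in Q0 *; nra.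
have [e e0 re_e] : exists2 e, 0 < e & forall z, A z -> e <= (theta b z).1.
  by exists Q^-1 => //; rewrite invr_gt0.
exists (1 + e)^-1; first by rewrite invr_ge0 invf_lt1 ?ltrDl ?e0 ?andbT; lra.
move=> z z' Az Az'; rewrite theta_dist //; [|exact: A_theta..].
rewrite mulrC ler_wpM2r ?sqmod_ge0 //.
have h u : A u -> 1 + e <= sqmod (cadd (theta b u) b).
  move=> Au; have := re_e u Au; have := gamma_ge1.
  move: (theta b u) => v g1 hv; rewrite /sqmod /cadd /=.
  have := sqr_ge0 (v.2 + b.2); have : 1 + e <= v.1 + b.1 by lra.
  by nra.
have h1 := h _ Az; have h2 := h _ Az'.
rewrite lef_pV2 ?posrE ?mulr_gt0 //; [nra|lra..].
Qed.

Lemma iter_theta b k z : b \in B -> A z -> A (iter k (theta b) z).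
Proof. by move=> bB Az; elim: k => [//|k IH] /=; exact: A_theta. Qed.

Lemma iter_theta_dist b z z' : b \in B -> A z -> A z' ->
  sqmod (csub (iter k (theta b) z) (iter k (theta b) z')) @[k --> \oo] --> (0 : R).
Proof.
move=> bB Az Az'; have [kap /andP[k0 k1] hk] := theta_contraction bB.
pose D k := sqmod (csub (iter k (theta b) z) (iter k (theta b) z')).
(* Contraction starts only after the first step, so the geometric bound is anchored at D 1. *)
have DS k : D k.+1 <= kap ^+ k * D 1%N.
  elim: k => [|k IH]; first by rewrite mul1r.
  apply: le_trans (hk _ _ (iter_theta k bB Az) (iter_theta k bB Az')) _.
  by rewrite exprS -mulrA ler_wpM2l.
rewrite -[X in X @ _ --> _]/D -cvg_shiftS.
apply: (@squeeze_cvgr _ _ _ R (fun=> 0) (fun k => kap ^+ k * D 1%N)).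
- by apply: filterE => k; rewrite sqmod_ge0 /=; exact: DS.
- exact: cvg_cst.
- rewrite -[X in _ --> X](mul0r (D 1%N)); apply: cvgMr_tmp; apply: cvg_expr.
  by rewrite ger0_norm.
Qed.

(* The two orbits merge, so a continuous function constant along each of them
   takes the same value on both. *)
Lemma orbit_values_eq b (q : R * R -> R) z z' c c' : b \in B -> A z -> A z' ->
  {within A, continuous q} ->
  (forall k, q (iter k (theta b) z) = c) ->
  (forall k, q (iter k (theta b) z') = c') -> c = c'.
Proof.
move=> bB Az Az' cq hc hc'.
have [F uF ooF] := ultrafilter_infty; have PF : ProperFilter F := ultra_proper.
have [p Ap hp] := ultra_compact_cvg uF A_compact (fun k => iter_theta k bB Az).
have [p' Ap' hp'] := ultra_compact_cvg uF A_compact (fun k => iter_theta k bB Az').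
have val u u' a : A u' -> (forall k, A (u k)) -> u @ F --> u' ->
    (forall k, q (u k) = a) -> q u' = a.
  move=> Au' Au hu ha.
  have h1 : q (u k) @[k --> F] --> q u'.
    move/subspace_continuousP/(_ _ Au') : cq => cq.
    apply: cvg_trans cq => V; rewrite /fmap /= /within /= => hV.
    apply: (@filterS _ F _ (fun k => A (u k) -> V (q (u k)))) (hu _ hV) => k h.
    exact: h (Au k).
  have h2 : q (u k) @[k --> F] --> a.
    by under eq_fun do rewrite ha; exact: cvg_cst.
  exact: cvg_unique h1 h2.
suff pp' : p = p'.
  rewrite -(val _ _ _ Ap (fun k => iter_theta k bB Az) hp hc) pp'.
  exact: (val _ _ _ Ap' (fun k => iter_theta k bB Az') hp' hc').
have D0 : sqmod (csub (iter k (theta b) z) (iter k (theta b) z')) @[k --> F] --> (0 : R).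
  by apply: cvg_trans (iter_theta_dist bB Az Az'); exact: cvg_app.
have c1 (u : nat -> R * R) (p0 : R * R) : u @ F --> p0 -> (u k).1 @[k --> F] --> p0.1.
  by move=> hu V hV; exact: (hu _ (cvg_fst_nbhs hV)).
have c2 (u : nat -> R * R) (p0 : R * R) : u @ F --> p0 -> (u k).2 @[k --> F] --> p0.2.
  by move=> hu V hV; exact: (hu _ (cvg_snd_nbhs hV)).
have Dp : sqmod (csub (iter k (theta b) z) (iter k (theta b) z')) @[k --> F] -->
    sqmod (csub p p').
  rewrite /sqmod /csub /= !expr2; under eq_fun do rewrite !expr2.
  by apply: cvgD; apply: cvgM; apply: cvgB; (exact: c1 || exact: c2).
have e0 : sqmod (csub p p') = 0 by exact: cvg_unique Dp D0.
move/eqP: e0; rewrite /sqmod /csub /=.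
rewrite paddr_eq0 ?sqr_ge0 // !sqrf_eq0 !subr_eq0 => /andP[/eqP e1 /eqP e2].
by rewrite [p]surjective_pairing [p']surjective_pairing e1 e2.
Qed.

(** Minimum principle: nonnegative terms sum to r f z = 0, so the term of b vanishes, and its weight
    is positive. *)
Lemma zero_theta f z (r : R) b : b \in B -> cmod b <= Rr -> A z ->
  (forall z, A z -> 0 <= f z) -> (forall z, A z -> L f z = r * f z) ->
  f z = 0 -> f (theta b z) = 0.
Proof.
move=> bB bR Az f0 hf fz.
have := Lop_ge_branch s gamma_ge1 B_ge al_ge0 A0 A_re A_theta bB bR Az f0.
rewrite -/L hf // fz mulr0 pmulr_lle0 ?hpow_gt0 // => h.
by apply/eqP; rewrite eq_le h f0 //; exact: A_theta.
Qed.

Lemma zero_origin f z (r : R) : 0 < al -> A z ->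
  (forall z, A z -> 0 <= f z) -> (forall z, A z -> L f z = r * f z) ->
  f z = 0 -> f (0, 0) = 0.
Proof.
move=> al0 Az f0 hf fz.
have := Lop_ge_const Rr al s gamma_ge1 B_ge A_re A_theta Az f0.
rewrite -/L hf // fz mulr0 pmulr_rle0 // => h.
by apply/eqP; rewrite eq_le h f0.
Qed.

Lemma eigenfunction_unique (v w : R * R -> R) (r : R) :
  {within A, continuous v} -> {within A, continuous w} ->
  (forall z, A z -> 0 < w z) ->
  (forall z, A z -> L v z = r * v z) -> (forall z, A z -> L w z = r * w z) ->
  exists c, forall z, A z -> v z = c * w z.
Proof.
move=> cv cw w0 Lv Lw.
pose q z := v z / w z.
have cq : {within A, continuous q}.
  move/subspace_continuousP in cv; move/subspace_continuousP in cw.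
  apply/subspace_continuousP => z Az; apply: cvgM; first exact: cv.
  by apply: cvgV; [rewrite gt_eqF // w0|exact: cw].
have An : A !=set0 by exists (0, 0).
have [z1 /set_mem Az1 hz1] := compact_EVT_min An A_compact cq.
have [z2 /set_mem Az2 hz2] := compact_EVT_max An A_compact cq.
(* Used for v - q(z1) w and q(z2) w - v, both nonnegative on A, vanishing at z1 and z2
   respectively. *)
have lin (a a' : R) z : A z -> L (fun z => a * v z + a' * w z) z =
    r * (a * v z + a' * w z).
  move=> Az; rewrite /L (LopP B Rr al s a v (fun z => a' * w z)).
  have := iter_LopZ B Rr al s 1 a' w z; rewrite /= => ->.
  by rewrite -/L Lv // Lw //; ring.
have qw z : A z -> q z * w z = v z by move=> Az; rewrite /q divfK // gt_eqF // w0.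
have lo z : A z -> 0 <= 1 * v z + - q z1 * w z.
  move=> Az; rewrite mul1r mulNr subr_ge0 -(qw z Az) ler_pM2r ?w0 //.
  by apply: hz1; rewrite inE.
have hi z : A z -> 0 <= -1 * v z + q z2 * w z.
  move=> Az; rewrite mulN1r addrC subr_ge0 -(qw z Az) ler_pM2r ?w0 //.
  by apply: hz2; rewrite inE.
have qlo z : A z -> 1 * v z + - q z1 * w z = 0 -> q z = q z1.
  move=> Az; rewrite mul1r mulNr => /eqP; rewrite subr_eq0 => /eqP e.
  by rewrite /q e mulfK // gt_eqF // w0.
have qhi z : A z -> -1 * v z + q z2 * w z = 0 -> q z = q z2.
  move=> Az; rewrite mulN1r addrC => /eqP; rewrite subr_eq0 => /eqP e.
  by rewrite {1}/q -e mulfK // gt_eqF // w0.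
have z1lo : 1 * v z1 + - q z1 * w z1 = 0 by rewrite mul1r mulNr qw // subrr.
have z2hi : -1 * v z2 + q z2 * w z2 = 0 by rewrite mulN1r qw // addNr.
suff q12 : q z1 = q z2.
  exists (q z1) => z Az; rewrite -(qw z Az); congr (_ * _); apply/eqP.
  by rewrite eq_le {1}q12 hz2 ?hz1 // inE.
case: nontrivial => [al_gt0|[b [bB bR]]].
  rewrite -(qlo _ A0 (zero_origin al_gt0 Az1 lo (lin 1 (- q z1)) z1lo)).
  exact: (qhi _ A0 (zero_origin al_gt0 Az2 hi (lin (-1) (q z2)) z2hi)).
apply: (orbit_values_eq bB Az1 Az2 cq) => k.
  apply: qlo; first exact: iter_theta.
  elim: k => [//|k IH].
  exact: (zero_theta bB bR (iter_theta k bB Az1) lo (lin 1 (- q z1)) IH).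
apply: qhi; first exact: iter_theta.
elim: k => [//|k IH].
exact: (zero_theta bB bR (iter_theta k bB Az2) hi (lin (-1) (q z2)) IH).
Qed.

End Uniqueness.

(** * Operator norms and the spectral radius *)

Section SpectralRadius.
Variable R : realType.

Lemma root_cvg (x : nat -> R) (r K : R) : 0 < r -> 0 < K ->
  (forall k, x k <= K * r ^+ k) -> (forall k, r ^+ k <= K * x k) ->
  (x k `^ (k%:R)^-1) @[k --> \oo] --> r.
Proof.
move=> r0 K0 hi lo.
have x0 k : 0 < x k.
  by rewrite -(pmulr_rgt0 _ K0); apply: lt_le_trans (lo k); rewrite exprn_gt0.
have h k : `|ln (x k.+1) - k.+1%:R * ln r| <= ln K.
  have := hi k.+1; rewrite -ler_ln ?posrE ?mulr_gt0 ?exprn_gt0 //.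
  rewrite lnM ?posrE ?exprn_gt0 // lnXn // => h1.
  have := lo k.+1; rewrite -ler_ln ?posrE ?mulr_gt0 ?exprn_gt0 //.
  rewrite lnM ?posrE // lnXn // => h2.
  rewrite mulr_natl ler_norml; apply/andP; split; lra.
(* The shift drops k = 0, where the exponent 1/0 is a default value. *)
rewrite -cvg_shiftS.
have hl : k.+1%:R^-1 * ln (x k.+1) @[k --> \oo] --> ln r.
  apply: (@squeeze_cvgr _ _ _ R (fun k => ln r - ln K * harmonic k)
    (fun k => ln r + ln K * harmonic k)).
  - apply: filterE => k; rewrite -ler_distl /harmonic /=.
    have -> : k.+1%:R^-1 * ln (x k.+1) - ln r =
        k.+1%:R^-1 * (ln (x k.+1) - k.+1%:R * ln r).
      by rewrite mulrBr mulKf // pnatr_eq0.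
    by rewrite normrM gtr0_norm ?invr_gt0 ?ltr0Sn // mulrC ler_pM2r ?invr_gt0 ?ltr0Sn.
  - rewrite -[X in _ --> X]subr0 -[X in _ - X](mulr0 (ln K)).
    apply: cvgB; [exact: cvg_cst|apply: cvgMl_tmp; exact: cvg_harmonic].
  - rewrite -[X in _ --> X]addr0 -[X in _ + X](mulr0 (ln K)).
    apply: cvgD; [exact: cvg_cst|apply: cvgMl_tmp; exact: cvg_harmonic].
have := cvg_comp _ _ hl (@continuous_expR R (ln r)).
rewrite lnK ?posrE //; apply: cvg_trans.
by apply: near_eq_cvg; apply: filterE => k /=; rewrite /powR gt_eqF.
Qed.

Variables (gamma : R) (B : seq (R * R)) (Rr al s : R).
Hypotheses (gamma_ge1 : 1 <= gamma) (B_ge : forall b, b \in B -> gamma <= b.1).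
Hypotheses (al_ge0 : 0 <= al).
Variables (A : set (R * R)).
Hypotheses (A0 : A (0, 0)) (A_re : forall z, A z -> 0 <= z.1)
  (A_theta : forall b z, b \in B -> A z -> A (theta b z))
  (A_compact : compact A).

Let L := Lop B Rr al s.

Lemma iter_LopC k (f : R * R -> R * R) : iter k (LopC B Rr al s) f =
  (fun z => (iter k L (fun p => (f p).1) z, iter k L (fun p => (f p).2) z)).
Proof.
elim: k => [|k IH] /=; first by apply/funext => z; rewrite -surjective_pairing.
by rewrite IH.
Qed.

Lemma cmod_le_normD (z : R * R) : cmod z <= `|z.1| + `|z.2|.
Proof.
rewrite -ler_sqr ?nnegrE ?addr_ge0 ?cmod_ge0 // cmod_sq /sqmod.
rewrite sqrrD !real_normK ?num_real // addrAC lerDl.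
by rewrite mulrn_wge0 // mulr_ge0.
Qed.

Lemma norm1_le_cmod (z : R * R) : `|z.1| <= cmod z.
Proof.
rewrite -ler_sqr ?nnegrE ?cmod_ge0 // cmod_sq real_normK ?num_real //.
by rewrite lerDl sqr_ge0.
Qed.

Lemma norm2_le_cmod (z : R * R) : `|z.2| <= cmod z.
Proof.
rewrite -ler_sqr ?nnegrE ?cmod_ge0 // cmod_sq real_normK ?num_real //.
by rewrite lerDr sqr_ge0.
Qed.

(** A real [sup] dominates its set only when the set is bounded above, which compactness of A
    supplies. *)
Lemma cmod_le_supn (f : R * R -> R * R) z : {within A, continuous f} -> A z ->
  cmod (f z) <= supn A f.
Proof.
move=> cf Az; apply: ub_le_sup; last by exists z.
have := compact_bounded (continuous_compact cf A_compact).
move=> [N [_ /(_ (N + 1))]]; rewrite ltrDl => /(_ ltr01) hN.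
exists ((N + 1) + (N + 1)) => _ [u Au <-].
have : `|f u| <= N + 1 by apply: hN; exists u.
rewrite prod_normE ge_max => /andP[n1 n2].
by apply: le_trans (cmod_le_normD _) _; rewrite lerD.
Qed.

Lemma iter_Lop_norm k (g : R * R -> R) z : A z -> (forall u, A u -> `|g u| <= 1) ->
  `|iter k L g z| <= iter k L (fun=> 1) z.
Proof.
move=> Az hg; rewrite ler_norml -mulN1r -[X in _ && (_ <= X)]mul1r -!iter_LopZ.
apply/andP; split; apply: (le_iter_Lop Rr s gamma_ge1 B_ge al_ge0 A0 A_re A_theta) => // u Au;
  by rewrite mulr1; move: (hg _ Au); rewrite ler_norml => /andP[].
Qed.

Variables (r K : R).
Hypotheses (r_gt0 : 0 < r) (K_gt0 : 0 < K).
Hypothesis growth_le : forall k z, A z -> iter k L (fun=> 1) z <= K * r ^+ k.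
Hypothesis growth_ge : forall k, r ^+ k <= K * iter k L (fun=> 1) (0, 0).

Let supn_iter_le k f : {within A, continuous f} -> supn A f <= 1 ->
  ubound [set cmod (iter k (LopC B Rr al s) f z) | z in A] (2 * K * r ^+ k).
Proof.
move=> cf f1 _ [z Az <-]; rewrite iter_LopC.
have hf u : A u -> cmod (f u) <= 1 by move=> Au; apply: le_trans f1; exact: cmod_le_supn.
apply: le_trans (cmod_le_normD _) _.
rewrite -mulrA mulr_natl mulr2n; apply: lerD.
  apply: le_trans (growth_le k Az); apply: iter_Lop_norm => // u Au.
  exact: le_trans (norm1_le_cmod _) (hf _ Au).
apply: le_trans (growth_le k Az); apply: iter_Lop_norm => // u Au.
exact: le_trans (norm2_le_cmod _) (hf _ Au).
Qed.

(** From above, real and imaginary parts are each dominated by L^k 1, whence a factor 2; from below,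
    the constant function 1 is tested at 0. *)
Lemma opnorm_root_cvg :
  (opnorm A (LopC B Rr al s) k `^ (k%:R)^-1) @[k --> \oo] --> r.
Proof.
pose one : R * R -> R * R := fun=> (1, 0).
have c1 : {within A, continuous one} by move=> z; exact: cvg_cst.
have cm1 (a : R) : 0 <= a -> cmod (a, 0) = a.
  by move=> a0; rewrite /cmod /= expr0n addr0 sqrtr_sqr ger0_norm.
have one1 : supn A one <= 1.
  by apply: ge_sup => [|_ [z _ <-]]; [exists (cmod (one (0, 0))), (0, 0)|rewrite cm1].
have Kge : 2 * K * r ^+ 0 >= 0 by rewrite !mulr_ge0 // ltW.
have img0 k f : [set cmod (iter k (LopC B Rr al s) f z) | z in A] !=set0.
  by exists (cmod (iter k (LopC B Rr al s) f (0, 0))), (0, 0).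
have ub k : ubound [set supn A (iter k (LopC B Rr al s) f) |
    f in [set f : R * R -> R * R | {within A, continuous f} /\ supn A f <= 1]]
    (2 * K * r ^+ k).
  move=> _ [f [cf f1] <-]; apply: ge_sup; [exact: img0|exact: supn_iter_le].
have iter00 k : iter k L (fun=> 0) (0, 0) = 0.
  by rewrite /L iter_Lop0.
have pos k : 0 <= iter k L (fun=> 1) (0, 0).
  rewrite -[leLHS](iter00 k).
  by apply: (le_iter_Lop Rr s gamma_ge1 B_ge al_ge0 A0 A_re A_theta) => // u _; exact: ler01.
apply: (@root_cvg _ r (2 * K)) => // [|k|k]; first by rewrite mulr_gt0.
- apply: ge_sup; last exact: ub.
  by exists (supn A (iter k (LopC B Rr al s) one)), one.
- apply: le_trans (growth_ge k) _; rewrite -mulrA [leRHS]mulr_natl mulr2n.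
  have : K * iter k L (fun=> 1) (0, 0) <= K * opnorm A (LopC B Rr al s) k.
    rewrite ler_pM2l //.
    apply: (@le_trans _ _ (supn A (iter k (LopC B Rr al s) one))).
      apply: ub_le_sup; first by exists (2 * K * r ^+ k); exact: supn_iter_le.
      by exists (0, 0) => //; rewrite iter_LopC /= iter00 cm1.
    by apply: ub_le_sup; [exists (2 * K * r ^+ k); exact: ub|exists one].
  by move=> h; have := mulr_ge0 (ltW K_gt0) (pos k); lra.
Qed.

End SpectralRadius.

(** * From the functional to the eigenfunction *)

Section Eigenfunction.
Variables (R : realType) (gamma : R) (B : seq (R * R)) (Rr al s : R).
Hypotheses (gamma_ge1 : 1 <= gamma) (B_ge : forall b, b \in B -> gamma <= b.1).
Hypotheses (al_ge0 : 0 <= al) (s_ge0 : 0 <= s).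
Variable Lam : (option (R * R) -> R) -> R.
Hypothesis LamP : positive_functional gamma Rr Lam.
Hypothesis Lam_gt0 : 0 < Lam (fun=> 1).

Let bnd := bounded_adm gamma Rr.
Let w z := average s Lam (TC 1) 1 z.

Lemma average_gt0 z : 0 <= z.1 -> 0 < w z.
Proof.
move=> z0; rewrite /w averageE.
apply: (@lt_le_trans _ _ (gen_lb Rr s (sqmod z) * Lam (fun=> 1))).
  by rewrite mulr_gt0 ?gen_lb_gt0.
rewrite -[leRHS]mul1r; apply: (Lam_leZ LamP) => [||o ao].
- exact: bounded_adm_cst.
- exact: bounded_gen.
- by rewrite mul1r mulr1; exact: (gen_ge gamma_ge1).
Qed.

(** Boundedness is carried through the induction because each use of linearity asks for it. *)
Lemma Lam_sum (l : seq (R * R)) (F : R * R -> option (R * R) -> R) C c phi :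
  (forall b, b \in l -> bnd (F b)) -> bnd phi ->
  bnd (fun o => \sum_(b <- l) F b o * C b + c * phi o) /\
  Lam (fun o => \sum_(b <- l) F b o * C b + c * phi o) =
  \sum_(b <- l) Lam (F b) * C b + c * Lam phi.
Proof.
move=> + bphi; elim: l => [|b l IH] bF.
  have e : (fun o => \sum_(b <- [::]) F b o * C b + c * phi o) = (fun o => c * phi o + 0).
    by apply/funext => o; rewrite big_nil addrC.
  have b0 := bounded_adm_cst gamma Rr 0.
  by rewrite e big_nil add0r (Lam_lin LamP) // (Lam0 LamP) addr0; split=> //;
    apply: bounded_admP.
have bb : bnd (F b) by apply: bF; rewrite inE eqxx.
have [|h1 h2] := IH; first by move=> b' b'l; apply: bF; rewrite inE b'l orbT.
have e : (fun o => \sum_(b <- b :: l) F b o * C b + c * phi o) =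
    (fun o => C b * F b o + (\sum_(b <- l) F b o * C b + c * phi o)).
  by apply/funext => o; rewrite big_cons [F b o * _]mulrC addrA.
rewrite e; split; first exact: bounded_admP.
by rewrite (Lam_lin LamP) // h2 big_cons addrA [Lam (F b) * _]mulrC.
Qed.

Lemma average_eigen r z :
  (forall phi, bnd phi -> Lam (Top B Rr al s phi) = r * Lam phi) ->
  0 <= z.1 -> Lop B Rr al s w z = r * w z.
Proof.
move=> eig z0; rewrite (LopE Rr al s gamma_ge1 B_ge) //.
have bg := bounded_gen Rr gamma_ge1 s_ge0 z0.
rewrite [in RHS]/w [in RHS]averageE -eig // -big_filter.
set l := [seq b <- B | cmod b <= Rr].
have lB b : b \in l -> b \in B by rewrite mem_filter => /andP[].
have bF b : b \in l -> bnd (gen s (theta b z)).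
  move=> /lB bB; apply: (bounded_gen Rr gamma_ge1 s_ge0).
  exact: (theta_re_ge0 gamma_ge1 z0 (B_ge bB)).
have b0 : bnd (gen s (0, 0)) by exact: bounded_gen.
have [b1 e1] := Lam_sum (fun b => hpow s (cadd z b)) al bF b0.
under eq_bigr do rewrite /w averageE; rewrite /w averageE -e1.
have bT := bounded_Top gamma_ge1 B_ge al_ge0 s_ge0 bg.
have transfer o : admissible gamma Rr o ->
    \sum_(b <- l) gen s (theta b z) o * hpow s (cadd z b) + al * gen s (0, 0) o =
    Top B Rr al s (gen s z) o.
  by move=> ao; rewrite -(gen_transfer al s gamma_ge1 B_ge z0 ao) big_filter.
(* The transfer identity holds at admissible parameters only, so monotonicity of Lam is applied in
   both directions. *)
by apply/eqP; rewrite eq_le; apply/andP; split;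
  apply: (Lam_le LamP b1 bT) || apply: (Lam_le LamP bT b1);
  move=> o ao; rewrite transfer.
Qed.

End Eigenfunction.

(** * Geometry of the domain and conjugation *)

Section Domain.
Variable R : realType.
Implicit Types (U : set (R * R)) (z : R * R).

Lemma closure_le0 U (f : R * R -> R) z : {within closure U, continuous f} ->
  (forall u, U u -> f u <= 0) -> closure U z -> f z <= 0.
Proof.
move=> /subspace_continuousP cf f0 Uz; rewrite leNgt; apply/negP => fz.
have := cf z Uz _ (lt_nbhsr fz).
rewrite /fmap /= /within /= => hV.
have [u [Uu hu]] := Uz _ hV.
have := hu (subset_closure Uu); rewrite /= => hfu.
by have := f0 u Uu; rewrite leNgt hfu.
Qed.

Lemma fst_continuous_within U : {within U, continuous (fun z : R * R => z.1)}.
Proof. apply: continuous_subspaceT => z; exact: cvg_fst_nbhs. Qed.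

Lemma snd_continuous_within U : {within U, continuous (fun z : R * R => z.2)}.
Proof. apply: continuous_subspaceT => z; exact: cvg_snd_nbhs. Qed.

Lemma closure_re_ge0 U z : (forall u, U u -> 0 < u.1) -> closure U z -> 0 <= z.1.
Proof.
move=> h Uz; rewrite -oppr_le0.
apply: (@closure_le0 U (fun z => - z.1)) => // [u|u Uu].
  by apply: cvgN; exact: fst_continuous_within.
by rewrite oppr_le0 ltW // h.
Qed.

Lemma closure_bounded U : bounded_set U ->
  exists N : R, forall z, closure U z -> `|z.1| <= N /\ `|z.2| <= N.
Proof.
move=> [N [_ /(_ (N + 1))]]; rewrite ltrDl => /(_ ltr01) hN; exists (N + 1) => z Uz.
have hU u : U u -> `|u.1| <= N + 1 /\ `|u.2| <= N + 1.
  by move=> /hN; rewrite /= prod_normE ge_max => /andP[].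
have bd (f : R * R -> R) : {within closure U, continuous f} ->
    (forall u, U u -> f u <= N + 1) -> f z <= N + 1.
  move=> cf hf; rewrite -subr_le0.
  apply: (@closure_le0 U (fun z => f z - (N + 1))) => // [u|u Uu].
    by apply: cvgB; [exact: cf|exact: cvg_cst].
  by rewrite subr_le0 hf.
have c1 := @fst_continuous_within (closure U).
have c2 := @snd_continuous_within (closure U).
split; rewrite ler_norml lerNl; apply/andP; split.
- apply: (bd (fun z => - z.1)) => [u|u /hU[]]; first by apply: cvgN; exact: c1.
  by rewrite ler_norml lerNl => /andP[].
- by apply: (bd (fun z => z.1)) => // u /hU[]; rewrite ler_norml => /andP[].
- apply: (bd (fun z => - z.2)) => [u|u /hU[_]]; first by apply: cvgN; exact: c2.
  by rewrite ler_norml lerNl => /andP[].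
- by apply: (bd (fun z => z.2)) => // u /hU[_]; rewrite ler_norml => /andP[].
Qed.

Lemma compact_closure U : bounded_set U -> compact (closure U).
Proof.
move=> /closure_bounded[N hN].
apply: (subclosed_compact (B := `[- N, N]%classic `*` `[- N, N]%classic)).
- exact: closed_closure.
- by apply: compact_setX; exact: segment_compact.
- by move=> z /hN[h1 h2]; split; rewrite /= in_itv /= -ler_norml.
Qed.

Lemma disk_sub_closure U z : interior (@Ddisk R) `<=` U -> Ddisk z -> closure U z.
Proof.
move=> DU Dz V /nbhs_ballP[e /= e0 eV].
(* Below both 1 and e: the homothety of ratio 1 - t about the centre 1/2 sends z into the open disc
   and moves it by less than e. *)
pose t := e / (1 + e).
have e1 : 0 < 1 + e by lra.
have t0 : 0 < t by rewrite divr_gt0.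
have t1 : t < 1 by rewrite ltr_pdivrMr // mul1r; lra.
have te : t < e by rewrite ltr_pdivrMr //; nra.
pose p : R * R := ((1 - t) * z.1 + t * 2^-1, (1 - t) * z.2).
have Dz' : (z.1 - 2^-1) ^+ 2 + z.2 ^+ 2 <= 4^-1 := Dz.
exists p; split.
  apply: DU; rewrite /interior /=.
  pose f (u : R * R) := (u.1 - 2^-1) * (u.1 - 2^-1) + u.2 * u.2.
  have cf : f u @[u --> p] --> f p.
    have c1 : u.1 - 2^-1 @[u --> p] --> p.1 - 2^-1.
      by apply: cvgB; [exact: cvg_fst_nbhs|exact: cvg_cst].
    by apply: cvgD; apply: cvgM; [exact: c1|exact: c1|exact: cvg_snd_nbhs..].
  have fp : f p < 4^-1.
    have -> : f p = (1 - t) ^+ 2 * ((z.1 - 2^-1) ^+ 2 + z.2 ^+ 2).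
      by rewrite /f /p /=; field.
    apply: (@le_lt_trans _ _ ((1 - t) ^+ 2 * 4^-1)).
      by rewrite ler_wpM2l ?sqr_ge0.
    by rewrite gtr_pMl ?invr_gt0 //; nra.
  apply: (@filterS _ (nbhs p) _ (fun u => f u < 4^-1)) (cvgr_lt _ cf _ fp) => u.
  by rewrite /Ddisk /= /f -!expr2 => /ltW.
apply: eV; split; rewrite /ball /= /p /=.
- have -> : z.1 - ((1 - t) * z.1 + t * 2^-1) = t * (z.1 - 2^-1) by ring.
  rewrite normrM gtr0_norm //.
  have : `|z.1 - 2^-1| <= 1.
    rewrite -ler_sqr ?nnegrE // real_normK ?num_real //.
    by have := sqr_ge0 z.2; lra.
  have := normr_ge0 (z.1 - 2^-1); nra.
- have -> : z.2 - (1 - t) * z.2 = t * z.2 by ring.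
  rewrite normrM gtr0_norm //.
  have : `|z.2| <= 1.
    rewrite -ler_sqr ?nnegrE // real_normK ?num_real //.
    by have := sqr_ge0 (z.1 - 2^-1); lra.
  have := normr_ge0 z.2; nra.
Qed.

(** For u = z + b, |1/u - 1/2|^2 = 1/4 + (1 - Re u)/|u|^2. With [disk_sub_closure] this makes the
    closure of U invariant under theta_b. *)
Lemma theta_disk (b z : R * R) : 1 <= b.1 -> 0 <= z.1 -> Ddisk (theta b z).
Proof.
move=> b1 z0; have : 1 <= (cadd z b).1 by rewrite /cadd /=; lra.
rewrite /theta; move: (cadd z b) => u u1.
have N0 : 0 < sqmod u by apply: sqmod_gt0; lra.
rewrite /Ddisk /= /cinv /= -/(sqmod u).
have -> : (u.1 / sqmod u - 2^-1) ^+ 2 + (- u.2 / sqmod u) ^+ 2 =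
    4^-1 + ((u.1 ^+ 2 + u.2 ^+ 2) / sqmod u - u.1) / sqmod u.
  by field; rewrite gt_eqF.
rewrite -/(sqmod u) divff ?gt_eqF // gerDl pmulr_lle0 ?invr_gt0 //; lra.
Qed.

Lemma zero_disk : Ddisk ((0, 0) : R * R).
Proof. by rewrite /Ddisk /=; lra. Qed.

Lemma theta_conjc (b z : R * R) : theta (conjc b) (conjc z) = conjc (theta b z).
Proof.
rewrite /theta /conjc /cinv /cadd /=; congr pair; last rewrite -!mulNr.
  by rewrite -opprD sqrrN.
by rewrite -opprD sqrrN.
Qed.

Lemma cmod_conjc (z : R * R) : cmod (conjc z) = cmod z.
Proof. by rewrite /cmod /= sqrrN. Qed.

Lemma Lop_conjc (B : seq (R * R)) (Rr al s : R) (f : R * R -> R) z : uniq B ->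
  (forall b, (b \in B) = (conjc b \in B)) ->
  Lop B Rr al s (fun u => f (conjc u)) z = Lop B Rr al s f (conjc z).
Proof.
move=> uB hB.
have conjK : involutive (@conjc R) by move=> [x y]; rewrite /conjc /= opprK.
have pB : perm_eq B (map (@conjc R) B).
  apply: uniq_perm => //; first by rewrite map_inj_uniq //; exact: can_inj conjK.
  move=> b; apply/idP/mapP => [bB|[b' b'B ->]]; last by rewrite -hB.
  by exists (conjc b); rewrite ?conjK -?hB.
have conj0 : conjc (0, 0) = (0, 0) :> R * R by rewrite /conjc oppr0.
rewrite /Lop conj0; apply: (congr1 (+%R^~ (al * f (0, 0)))).
rewrite [RHS](perm_big _ pB) big_map.
apply: eq_big => [b|b _]; first by rewrite cmod_conjc.
rewrite theta_conjc; have -> // : cmod (cadd z b) = cmod (cadd (conjc z) (conjc b)).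
by rewrite -cmod_conjc /conjc /cadd opprD.
Qed.

End Domain.

Theorem theorem3p1 (R : realType) (U : set (R * R)) (gamma : R)
  (B : seq (R * R)) (Rr al : R) :
  open U -> bounded_set U -> mildly_regular U ->
  interior (@Ddisk R) `<=` U ->
  (forall p, U p -> 0 < p.1) ->
  1 <= gamma ->
  uniq B -> (forall b, b \in B -> gamma <= b.1) ->
  0 < Rr -> 0 <= al ->
  (0 < al \/ exists b, b \in B /\ cmod b <= Rr) ->
  forall s : R, 0 <= s ->
  exists (w : R * R -> R) (r : R),
    (* r = r(L) = lim ||L^k||^(1/k) > 0 *)
    (fun k : nat => opnorm (closure U) (LopC B Rr al s) k `^ (k%:R)^-1)
        @ \oo --> r /\
    0 < r /\
    (* w is continuous, strictly positive, an eigenfunction for r *)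
    {within closure U, continuous w} /\
    (forall z, closure U z -> 0 < w z) /\
    (forall z, closure U z -> Lop B Rr al s w z = r * w z) /\
    (* uniqueness up to scalar multiples *)
    (forall v : R * R -> R, {within closure U, continuous v} ->
       (forall z, closure U z -> 0 < v z) ->
       (forall z, closure U z -> Lop B Rr al s v z = r * v z) ->
       exists c : R, forall z, closure U z -> v z = c * w z) /\
    (* conjugation symmetry *)
    ((forall b, (b \in B) = (conjc b \in B)) ->
     (forall z, U z <-> U (conjc z)) ->
     forall z, closure U z -> w (conjc z) = w z) /\
    smooth_closure U w /\
    (* (i) *)
    (forall z0 z1, closure U z0 -> closure U z1 ->
       w z0 <= w z1 * expR ((Num.sqrt 5 * s / gamma) * cmod (csub z1 z0))) /\
    (* (ii) *)
    (forall x1 x2 y, 0 <= x1 -> x1 <= x2 ->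
       closure U (x1, y) -> closure U (x2, y) ->
       w (x2, y) <= w (x1, y) /\
       w (x1, y) * expR ((- 2 * s / gamma) * (x2 - x1)) <= w (x2, y)) /\
    (* (iii) *)
    (forall x y1 y2, closure U (x, y1) -> closure U (x, y2) ->
       w (x, y1) <= w (x, y2) * expR ((s / gamma) * `|y1 - y2|)) /\
    (* (iv) D_xx w on the closure of U (continuous extension) *)
    (forall g, pext U w [:: false; false] g ->
       forall p, closure U p ->
         - (s / (4 * gamma ^+ 2 * (s + 1))) * w p <= g p /\
         g p <= (2 * s * (2 * s + 1) / gamma ^+ 2) * w p) /\
    (* (v) D_yy w on the closure of U (continuous extension) *)
    (forall g, pext U w [:: true; true] g ->
       forall p, closure U p ->
         - (2 * s / gamma ^+ 2) * w p <= g p /\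
         g p <= (2 * s * (2 * s + 1) / (4 * gamma ^+ 2)) * w p).
Proof.
move=> oU bU _ DU U_re gamma_ge1 uB B_ge Rr0 al_ge0 nontrivial s s_ge0.
pose A := closure U.
have A_re z : A z -> 0 <= z.1 by exact: closure_re_ge0.
have DA z : Ddisk z -> A z by exact: disk_sub_closure.
have A0 : A (0, 0) by apply: DA; exact: zero_disk.
have A_theta b z : b \in B -> A z -> A (theta b z).
  move=> bB Az; apply: DA; apply: theta_disk; last exact: A_re.
  exact: le_trans gamma_ge1 (B_ge b bB).
have A_compact : compact A by exact: compact_closure.
have [N hN] := closure_bounded bU.
have A_bd z : A z -> sqmod z <= 2 * N ^+ 2.
  move=> /hN[h1 h2]; rewrite /sqmod -[z.1 ^+ 2]real_normK ?num_real //.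
  rewrite -[z.2 ^+ 2]real_normK ?num_real //.
  have := normr_ge0 z.1; have := normr_ge0 z.2; nra.
have [r r0 hr] := spectral_growth gamma_ge1 B_ge al_ge0 s_ge0 nontrivial A0 A_re A_bd A_theta.
set c := gen_lb Rr s (2 * N ^+ 2) in hr.
have c0 : 0 < c by exact: gen_lb_gt0.
have Tle k z : A z ->
    iter k (Lop B Rr al s) (fun=> 1) z <= iter k (Top B Rr al s) (fun=> 1) None.
  by apply: (iter_Lop1_le Rr gamma_ge1 B_ge al_ge0 s_ge0 A_re).
have Tge k z : A z ->
    c * iter k (Top B Rr al s) (fun=> 1) None <= iter k (Lop B Rr al s) (fun=> 1) z.
  by apply: (@iter_Lop1_ge _ gamma B Rr al s gamma_ge1 B_ge al_ge0 s_ge0 A _ A_re A_bd).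
have c1 : c <= 1 by apply: gen_lb_le1 => //; rewrite mulr_ge0 ?sqr_ge0.
(* One factor comes from the growth of L^k 1 at 0, the other from comparing T^k 1 with it. *)
pose K := c^-1 * c^-1.
have ci : 1 <= c^-1 by rewrite invr_ge1 ?unitfE ?gt_eqF ?c0.
have K0 : 0 < K by rewrite mulr_gt0 ?invr_gt0.
have S0le k : iter k (Lop B Rr al s) (fun=> 1) (0, 0) <= c^-1 * r ^+ k.
  by rewrite mulrC ler_pdivlMr // mulrC; exact: (hr k).1.
have a_le k : iter k (Top B Rr al s) (fun=> 1) None <= K * r ^+ k.
  rewrite /K -mulrA mulrC ler_pdivlMr // mulrC.
  exact: le_trans (Tge k _ A0) (S0le k).
have S_le k z : A z -> iter k (Lop B Rr al s) (fun=> 1) z <= K * r ^+ k.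
  by move=> Az; exact: le_trans (Tle k z Az) (a_le k).
have S_gt0 k : 0 < iter k (Lop B Rr al s) (fun=> 1) (0, 0).
  have := lt_le_trans (exprn_gt0 k r0) (hr k).2.
  by rewrite pmulr_rgt0 // invr_gt0.
have S_ge k : r ^+ k <= K * iter k (Lop B Rr al s) (fun=> 1) (0, 0).
  apply: le_trans (hr k).2 _; rewrite /K ler_pM2r // ler_peMl //.
  by rewrite invr_ge0 ltW.
have a_ge k : r ^+ k <= K * iter k (Top B Rr al s) (fun=> 1) None.
  by apply: le_trans (S_ge k) _; rewrite ler_pM2l //; exact: Tle.
have [Lam [LamP Lam_gt0 eig]] :=
  eigenfunctional gamma_ge1 B_ge al_ge0 s_ge0 r0 K0 a_le a_ge.
pose w := average s Lam (TC 1) 1.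
have w_cont : {within A, continuous w} by exact: (average_continuous gamma_ge1 s_ge0 LamP).
have w_gt0 z : 0 <= z.1 -> 0 < w z by exact: (average_gt0 gamma_ge1 s_ge0 LamP).
have w_eig z : 0 <= z.1 -> Lop B Rr al s w z = r * w z.
  exact: (average_eigen gamma_ge1 B_ge al_ge0 s_ge0 LamP).
have w_unique v : {within A, continuous v} ->
    (forall z, A z -> Lop B Rr al s v z = r * v z) ->
    exists c, forall z, A z -> v z = c * w z.
  move=> v_cont v_eig.
  apply: (eigenfunction_unique gamma_ge1 B_ge al_ge0 nontrivial A0 A_re A_bd A_theta
    A_compact v_cont w_cont _ v_eig) => z Az; first exact/w_gt0/A_re.
  exact/w_eig/A_re.
exists w, r; split.
  exact: (opnorm_root_cvg gamma_ge1 B_ge al_ge0 A0 A_re A_theta A_compact r0 K0).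
split=> //; split=> //; split; first by move=> z /A_re /w_gt0.
split; first by move=> z /A_re /w_eig.
split; first by move=> v v_cont _; exact: w_unique.
split.
  (* Conjugation preserves the half plane, where w satisfies the eigenvalue equation, so w composed
     with it is again an eigenfunction and equals k w; the real point 0 forces k = 1. *)
  move=> Bc _ z Az.
  have [L hL] := average_lipschitz gamma_ge1 s_ge0 LamP (TC 1) 1.
  have v_cont : {within A, continuous (fun u => w (conjc u))}.
    apply: (@lipschitz_continuous_within _ _ _ L) => u u' /A_re u0 /A_re u'0.
    apply: le_trans (hL (conjc u) (conjc u') u0 u'0) _.
    by rewrite /conjc /= -opprD normrN.
  have [|k hk] := w_unique _ v_cont.
    by move=> u /A_re u0; rewrite Lop_conjc // w_eig.
  have := hk _ A0; rewrite /conjc /= oppr0 => /esym/eqP.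
  rewrite -subr_eq0 -{2}[w _]mul1r -mulrBl mulf_eq0 subr_eq0.
  rewrite [w _ == 0]gt_eqF ?w_gt0 // orbF => /eqP k1.
  by have := hk z Az; rewrite k1 mul1r.
split.
  move=> ds; split=> [d p Up|]; first exact: (pderivable_average gamma_ge1 s_ge0 LamP _ _ (U_re _ Up)).
  exists (average s Lam (foldr (dgterm s) (TC 1) ds) (base_const R ds)); split.
    exact: (average_continuous gamma_ge1 s_ge0 LamP).
  by move=> p /U_re p0; rewrite (pderiv_average gamma_ge1 s_ge0 LamP).
split; first by move=> z0 z1 /A_re h0 /A_re h1; exact: (average_harnack gamma_ge1 s_ge0 LamP).
split.
  move=> x1 x2 y x10 x12 _ _; split.
    exact: (average_decr_re gamma_ge1 s_ge0 LamP).
  exact: (average_ge_re gamma_ge1 s_ge0 LamP).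
split; first by move=> x y1 y2 /A_re x0 _; exact: (average_vertical gamma_ge1 s_ge0 LamP).
(* An extension g is tied to the derivative on U alone; the inequalities reach the closure by
   continuity of g and w. *)
have second ds C1 C2 : (forall z, 0 <= z.1 ->
      - C1 * w z <= average s Lam (foldr (dgterm s) (TC 1) ds) (base_const R ds) z /\
      average s Lam (foldr (dgterm s) (TC 1) ds) (base_const R ds) z <= C2 * w z) ->
    forall g, pext U w ds g -> forall p, A p ->
    - C1 * w p <= g p /\ g p <= C2 * w p.
  move=> h g [g_cont gE] p Ap.
  have hU u : U u -> - C1 * w u <= g u /\ g u <= C2 * w u.
    move=> Uu; have u0 := U_re u Uu.
    by rewrite gE // (pderiv_average gamma_ge1 s_ge0 LamP) //; apply: h; exact: ltW.
  split; rewrite -subr_le0.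
    apply: (@closure_le0 R U (fun u => - C1 * w u - g u)) => // [u|u /hU[h1 _]].
      by apply: cvgB; [apply: cvgMl_tmp; exact: w_cont|exact: g_cont].
    by rewrite subr_le0.
  apply: (@closure_le0 R U (fun u => g u - C2 * w u)) => // [u|u /hU[_ h2]].
    by apply: cvgB; [exact: g_cont|apply: cvgMl_tmp; exact: w_cont].
  by rewrite subr_le0.
split; apply: second => z z0.
  exact: (average_xx gamma_ge1 s_ge0 LamP).
exact: (average_yy gamma_ge1 s_ge0 LamP).
Qed.
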